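(* Let $\pi:P\to M$ be a fiber bundle over an $n$-dimensional manifold $M$, let $\omega$ be a $(k+1-r)$-horizontal $(k+1)$-form of constant rank on $P$, where $1\le r\le k+1$ and $k+1-r\le n$, and let $\hat\omega$ be its symbol, which is a vertical $r$-form on $P$ taking values in the bundle $\bigwedge^{k+1-r}T^*M$ of $(k+1-r)$-forms on $M$. Suppose that $\omega$ is multilagrangian, with multilagrangian distribution $L$. Then $\hat\omega$ is polylagrangian, with polylagrangian distribution $L$, and $$\ker\omega\subset\ker\hat\omega .$$ If $\omega$ is multipresymplectic, then $\hat\omega$ is polypresymplectic, with $$\dim\ker\hat\omega-\dim\ker\omega\le1 .$$
   Context: Vector spaces are real and finite-dimensional. Algebra: let $0\to V\to W\xrightarrow{\pi}T\to0$ be a short exact sequence of vector spaces, $V$ being regarded as a subspace of $W$. A form $\alpha\in\bigwedge^mW^*$ is $(m-s)$-horizontal if $\mathrm i_{v_1}\cdots\mathrm i_{v_{s+1}}\alpha=0$ for all $v_1,\dots,v_{s+1}\in V$; the space of these is $\bigwedge^m_sW^*$. For $\omega\in\bigwedge^{k+1}_rW^*$ let $\omega^\flat(w)=\mathrm i_w\omega$ and $\ker\omega=\ker\omega^\flat\subset W$. For a subspace $L\subset V$ let $L^\perp\subset W^*$ be its annihilator in $W^*$ and $\bigwedge^k_{r-1}L^\perp=\bigwedge^kL^\perp\cap\bigwedge^k_{r-1}W^*$. A non-vanishing $\omega\in\bigwedge^{k+1}_rW^*$ is multilagrangian of rank $N$ and horizontality degree $k+1-r$ if $V$ has a subspace $L$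 of codimension $N$ in $V$ with $\omega^\flat(L)=\bigwedge^k_{r-1}L^\perp$ (a multilagrangian subspace). The symbol of $\omega$ is the $\bigwedge^{k+1-r}T^*$-valued $r$-form $\hat\omega$ on $V$ given by $\hat\omega(v_1,\dots,v_r)(t_1,\dots,t_{k+1-r})=\omega(v_1,\dots,v_r,\mathfrak s(t_1),\dots,\mathfrak s(t_{k+1-r}))$ for any linear splitting $\mathfrak s:T\to W$ of $\pi$ (the result is independent of $\mathfrak s$). A non-vanishing $r$-form $\hat\omega\in\bigwedge^rV^*\otimes\hat T$ on $V$ with values in a vector space $\hat T$ is polylagrangian of rank $N$ if $V$ has a subspace $L$ of codimension $N$ with $\hat\omega^\flat(L)=(\bigwedge^{r-1}L^\perp)\otimes\hat T$, where here $L^\perp\subset V^*$ is the annihilator in $V^*$ and $\hat\omega^\flat(v)=\mathrm i_v\hat\omega$ for $v\in V$; such an $L$ is a polylagrangian subspace; $\ker\hat\omega=\ker\hat\omega^\flat\subset V$. Geometry: for a fiber bundle $\pi:P\to M$, all this is applied at each $p\in P$ with $W=T_pP$, $V=V_pP=\ker T_p\pi$, $T=T_{\pi(p)}M$; the symbol of a form $\omega$ on $P$ is the vertical form $\hat\omega$ whose value at $p$ is the symbol of $\omega_p$. The form $\omega$ on $P$ is multilagrangian (of rank $N$) if it has constant rank (kernel of constant dimension), $d\omega=0$, and each $\omega_p$ is multilagrangian of rank $N$; if the multilagrangian subspaces at the different points of $P$ fit together into a distribution $L$ on $P$ (contained in the vertical bundle $VP$), this is called the multilagrangian distribution of $\omega$.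 The form is multipresymplectic if moreover $k=n$ and $r=2$. A vertical $r$-form with values in a vector bundle $\hat T$ over $M$ is a section $\hat\omega$ of $\bigwedge^rV^*P\otimes\pi^*\hat T$; $d_V$ is the fiberwise exterior derivative (on each fiber $P_m$ the form is an ordinary form with values in the fixed vector space $\hat T_m$). It is polylagrangian (of rank $N$) if it has constant rank, $d_V\hat\omega=0$, and each $\hat\omega_p$ is polylagrangian of rank $N$ on $V_pP$; if the polylagrangian subspaces at the different points fit together into a distribution on $P$, this is called the polylagrangian distribution of $\hat\omega$. It is polypresymplectic if moreover $r=2$.
   Formalization: That ω̂ is polylagrangian/polypresymplectic is claimed only for r ≤ N+1, N the rank (for r > N+1 the symbol vanishes identically); ker ω ⊂ ker ω̂ is claimed only for k ≥ 1 (for k = 0, ω = dy on R²→R, (x,y)↦x, is a counterexample). *)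

(* Defs.v *)
From HB Require Import structures.
From mathcomp Require Import all_boot all_order all_algebra.
From mathcomp Require Import all_classical all_reals all_analysis.
Set Implicit Arguments.
Unset Strict Implicit.
Unset Printing Implicit Defensive.
Import Order.TTheory GRing.Theory Num.Theory numFieldNormedType.Exports.

Local Open Scope classical_set_scope.
Local Open Scope ring_scope.

(** * Alternating forms *)

Section Alternating.
Context {R : realType}.
Implicit Types (A W : lmodType R) (E : lmodType R).

Definition tsubst (m : nat) W (u : m.-tuple W) (i : 'I_m) (x : W) : m.-tuple W :=
  [tuple if j == i then x else tnth u j | j < m].

Definition alternating (m : nat) W E (f : m.-tuple W -> E) : Prop :=
  (forall u i a x y,
     f (tsubst u i (a *: x + y)) = a *: f (tsubst u i x) + f (tsubst u i y)) /\
  (forall u i j, i != j -> tnth u i = tnth u j -> f u = 0).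

Definition alternating_pred m W E : {pred (m.-tuple W -> E)} :=
  [pred f | `[< alternating f >]].
Arguments alternating_pred : clear implicits.

Lemma alternating_submod m W E : submod_closed (alternating_pred m W E).
Proof.
split=> [|a f g]; rewrite !inE.
  by split=> [u i b x y|u i j _ _] /=; rewrite ?scaler0 ?addr0.
move=> [fl fa] [gl ga]; split=> [u i b x y|u i j ij e].
  rewrite !fctE fl gl !scalerDr !scalerA (mulrC a) addrACA; congr (_ + _).
by rewrite !fctE (fa _ _ _ ij e) (ga _ _ _ ij e) scaler0 addr0.
Qed.

HB.instance Definition _ m W E :=
  GRing.isSubmodClosed.Build R (m.-tuple W -> E) (alternating_pred m W E)
    (alternating_submod m W E).

Record altform (m : nat) W E := AltForm {
  altfun :> m.-tuple W -> E;
  altfunP : altfun \in alternating_pred m W E }.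

HB.instance Definition _ m W E := [isSub for @altfun m W E].
HB.instance Definition _ m W E := [Choice of altform m W E by <:].
HB.instance Definition _ m W E :=
  [SubChoice_isSubLmodule of altform m W E by <:].

Lemma alternating_comp r m A W E (f : m.-tuple W -> E) (g : r.-tuple A -> m.-tuple W)
    (l : A -> W) (pos : 'I_r -> 'I_m) :
  alternating f -> linear l -> injective pos ->
  (forall u i x, g (tsubst u i x) = tsubst (g u) (pos i) (l x)) ->
  (forall u i, tnth (g u) (pos i) = l (tnth u i)) ->
  alternating (f \o g).
Proof.
move=> [fl fa] ll pi gs gt; split=> [u i a x y|u i j ij e] /=.
  by rewrite !gs ll fl.
apply: (fa _ (pos i) (pos j)); first by rewrite (inj_eq pi).
by rewrite !gt e.
Qed.

End Alternating.
Arguments alternating_pred {R} m W E.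


Section Contraction.
Context {R : realType}.
Implicit Types (W : lmodType R) (E : lmodType R).

(* For m = 0 the definition returns w-independent junk; it is only used on forms
   of positive degree. *)
Definition contr_fun (m : nat) W E (w : W) (f : m.-tuple W -> E) (u : m.-1.-tuple W) : E :=
  f [tuple nth 0 (w :: u) i | i < m].

Lemma contr_subproof m W E (w : W) (f : altform m W E) :
  contr_fun w f \in alternating_pred m.-1 W E.
Proof.
case: m f => [|m] f; rewrite inE; first by split=> u [].
have fP : alternating f by have := altfunP f; rewrite inE.
have nthE (t : m.-tuple W) i : nth 0 (w :: t) (lift ord0 i) = tnth t i.
  by rewrite lift0 /= (tnth_nth 0).
apply: (@alternating_comp _ m m.+1 W W E f
  (fun u : m.-tuple W => [tuple nth 0 (w :: u) i | i < m.+1]) id (lift ord0)) => //.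
- exact: lift_inj.
- move=> u i x; apply: eq_from_tnth => j; rewrite !tnth_mktuple.
  case: (unliftP ord0 j) => [j' ->|->]; last by rewrite -val_eqE.
  by rewrite (inj_eq (@lift_inj _ ord0)) !nthE tnth_mktuple.
- by move=> u i; rewrite tnth_mktuple nthE.
Qed.

(* i_w f *)
Definition contr m W E (w : W) (f : altform m W E) : altform m.-1 W E :=
  AltForm (contr_subproof w f).

End Contraction.

(** * Multilagrangian and polylagrangian forms on vector spaces *)

Section LinearAlgebra.
Context {R : realType}.
Implicit Types (W V T : vectType R) (E : lmodType R).

(* The subspace of W whose carrier is A. *)
Definition vspace_of W (A : set W) : {vspace W} :=
  xget 0%VS [set K | forall x, x \in K <-> A x].

Lemma mem_vspace_of W (A : set W) : A 0 ->
  (forall a x y, A x -> A y -> A (a *: x + y)) ->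
  forall x, x \in vspace_of A <-> A x.
Proof.
move=> A0 AD; rewrite /vspace_of; case: xgetP => [K _ //|noK]; exfalso.
pose P := fun n => `[< exists K : {vspace W}, (forall x, x \in K -> A x) /\ \dim K = n >].
have exP : exists n, P n.
  exists 0%N; apply/asboolP; exists 0%VS; rewrite dimv0; split=> // x.
  by rewrite memv0 => /eqP ->.
have ubP n : P n -> (n <= \dim {:W})%N.
  by move=> /asboolP [K [_ <-]]; exact: dimvS (subvf K).
case: (ex_maxnP exP ubP) => d /asboolP [K [KA dK]] maxd.
apply: (noK K) => x; split=> [|Ax]; first exact: KA.
apply: contrapT => /negP xK.
have : P (\dim (K + <[x]>)).
  apply/asboolP; exists (K + <[x]>)%VS; split=> // y.
  move=> /memv_addP [v vK [_ /vlineP [a ->] ->]].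
  by rewrite addrC; apply: AD => //; exact: KA.
move=> /maxd; rewrite -dK leqNgt; apply/negP/negPn.
rewrite (ltn_leqif (dimv_leqif_sup (addvSl K <[x]>))).
by apply: contra xK => h; rewrite memvE; exact: subv_trans (addvSr K _) h.
Qed.

(* ker f = {w | i_w f = 0} *)
Definition formker m W E (f : altform m W E) : {vspace W} :=
  vspace_of [set w | contr w f = 0].

Lemma mem_formker m W E (f : altform m W E) w : (0 < m)%N ->
  w \in formker f <-> contr w f = 0.
Proof.
case: m f => // m f _.
have [fl _] : alternating f by have := altfunP f; rewrite inE.
have contrE x u : contr x f u =
    f (tsubst [tuple nth 0 (0 :: u) i | i < m.+1] ord0 x).
  congr (altfun f _); apply: eq_from_tnth => i; rewrite !tnth_mktuple.
  by case: (unliftP ord0 i) => [j ->|->].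
have contrD a x y : contr (a *: x + y) f = a *: contr x f + contr y f.
  apply: val_inj; apply: funext => u.
  by rewrite [LHS]contrE fl -!contrE.
apply: mem_vspace_of => [|a x y] /=; last first.
  by rewrite contrD => -> ->; rewrite scaler0 addr0.
by have := contrD (-1) 0 0; rewrite scaler0 addr0 scaleN1r addNr.
Qed.

(* (\bigwedge^m L^\perp) (x) E, where L^\perp \subset W^* is the annihilator of L:
   the finite sums of terms (a_1 /\ ... /\ a_m) (x) e with a_i \in L^\perp, e \in E,
   where (a_1 /\ ... /\ a_m)(u_1, ..., u_m) = det (a_i u_j). *)
Definition ext_annihilator m W E (L : {vspace W}) : set (altform m W E) :=
  [set f : altform m W E |
    exists (q : nat) (a : 'I_q -> 'I_m -> 'Hom(W, R^o)) (e : 'I_q -> E),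
      (forall c i, (L <= lker (a c i))%VS) /\
      forall u : m.-tuple W,
        f u = \sum_(c < q) \det (\matrix_(i, j) (a c i (tnth u j) : R)) *: e c].

(* f is (m-s)-horizontal: the contraction with any s+1 vectors of V vanishes
   (which is no condition if s >= m). *)
Definition horizontal m s W (V : {vspace W}) (f : altform m W R^o) : Prop :=
  (s < m)%N -> forall u : m.-tuple W,
    (forall i : 'I_m, (i <= s)%N -> tnth u i \in V) -> f u = 0.

Definition multilagrangian_subspace k r N W (V : {vspace W})
    (f : altform k.+1 W R^o) (L : {vspace W}) : Prop :=
  [/\ (L <= V)%VS, \dim V = (\dim L + N)%N &
      [set (contr l f : altform k W R^o) | l in [set` L]] =
      ext_annihilator L `&` [set g | horizontal r.-1 V g]].

(* "of rank N and horizontality degree k+1-r" *)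
Definition multilagrangian_at k r N W (V : {vspace W}) (f : altform k.+1 W R^o) : Prop :=
  [/\ horizontal r V f, f != 0 &
      exists L, multilagrangian_subspace r N V f L].

Definition polylagrangian_subspace r N V E (f : altform r V E) (L : {vspace V}) : Prop :=
  \dim {:V} = (\dim L + N)%N /\
  [set contr l f | l in [set` L]] = ext_annihilator L.

Definition polylagrangian_at r N V E (f : altform r V E) : Prop :=
  f != 0 /\ exists L, polylagrangian_subspace N f L.

Section Symbol.
Context {W T : vectType R} (p : 'Hom(W, T)) (k r : nat) (hr : (r <= k.+1)%N).
Let V := subvs_of (lker p).

(* (p^-1)%VF is a right inverse of p on its image, i.e. a linear splitting of
   0 -> ker p -> W -> T -> 0 if p is onto. *)
Definition symbol_args (v : r.-tuple V) (t : (k.+1 - r).-tuple T) : k.+1.-tuple W :=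
  [tuple nth 0 (map vsval v ++ map (p^-1)%VF t) i | i < k.+1].

Lemma symbol_argsl v t i : tnth (symbol_args v t) (widen_ord hr i) = vsval (tnth v i).
Proof.
rewrite tnth_mktuple nth_cat size_map size_tuple /= ltn_ord.
by rewrite (nth_map 0) ?size_tuple // (tnth_nth 0).
Qed.

Lemma symbol_pos_subproof (j : 'I_(k.+1 - r)) : (r + j < k.+1)%N.
Proof. by rewrite -ltn_subRL. Qed.
Let rpos j := Ordinal (symbol_pos_subproof j).

Lemma symbol_argsr v t j : tnth (symbol_args v t) (rpos j) = (p^-1)%VF (tnth t j).
Proof.
rewrite tnth_mktuple nth_cat size_map size_tuple /= ltnNge leq_addr /= addKn.
by rewrite (nth_map 0) ?size_tuple // (tnth_nth 0).
Qed.

Lemma symbol_posP (i : 'I_k.+1) : (exists j, i = widen_ord hr j) \/ exists j, i = rpos j.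
Proof.
have [ir|ri] := ltnP i r; first by left; exists (Ordinal ir); exact: val_inj.
have h : (i - r < k.+1 - r)%N by rewrite ltn_sub2r // (leq_ltn_trans ri).
by right; exists (Ordinal h); apply: val_inj; rewrite /= subnKC.
Qed.

Lemma symbol_pos_neq i j : (widen_ord hr i == rpos j) = false.
Proof. by rewrite -val_eqE /= ltn_eqF // ltn_addr. Qed.

Lemma symbol_inner (f : altform k.+1 W R^o) v :
  (fun t => f (symbol_args v t)) \in alternating_pred (k.+1 - r) T R^o.
Proof.
have fP : alternating f by have := altfunP f; rewrite inE.
have rpos_inj : injective rpos by move=> i j [] /addnI /val_inj.
rewrite inE; apply: (alternating_comp (l := (p^-1)%VF) (pos := rpos) fP) => //.
- exact: linearP.
- move=> t i x; apply: eq_from_tnth => j; rewrite [RHS]tnth_mktuple.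
  have [[j' ->]|[j' ->]] := symbol_posP j; first by rewrite symbol_pos_neq !symbol_argsl.
  by rewrite (inj_eq rpos_inj) !symbol_argsr tnth_mktuple; case: ifP.
- by move=> t i; exact: symbol_argsr.
Qed.

Lemma symbol_outer (f : altform k.+1 W R^o) :
  (fun v => AltForm (symbol_inner f v)) \in
    alternating_pred r V (altform (k.+1 - r) T R^o).
Proof.
have fP : alternating f by have := altfunP f; rewrite inE.
have winj : injective (widen_ord hr) by move=> i j [] /val_inj.
have aP t : alternating (fun v => f (symbol_args v t)).
  apply: (alternating_comp (l := vsval) (pos := widen_ord hr) fP) => //.
  - move=> v i x; apply: eq_from_tnth => j; rewrite [RHS]tnth_mktuple.
    have [[j' ->]|[j' ->]] := symbol_posP j.
      by rewrite (inj_eq winj) !symbol_argsl tnth_mktuple; case: ifP.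
    by rewrite eq_sym symbol_pos_neq !symbol_argsr.
  - by move=> v i; exact: symbol_argsl.
rewrite inE; split=> [v i a x y|v i j ij e]; apply: val_inj; apply: funext => t.
  exact: (aP t).1.
exact: (aP t).2 ij e.
Qed.

(* symbol f v_1 .. v_r t_1 .. = f (v_1, .., v_r, s t_1, .., s t_(k+1-r)) for the splitting
   s := p^-1; if f is (k+1-r)-horizontal, every splitting gives the same value. *)
Definition symbol (f : altform k.+1 W R^o) : altform r V (altform (k.+1 - r) T R^o) :=
  AltForm (symbol_outer f).

End Symbol.
End LinearAlgebra.

(** * Smooth manifolds and fiber bundles *)

Section Smooth.
Context {R : realType}.

Fixpoint Ck (k : nat) (X Y : normedModType R) (U : set X) (f : X -> Y) : Prop :=
  if k is k'.+1 then
    (forall x, U x -> differentiable f x) /\ (forall v, Ck k' U (fun x => 'D_v f x))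
  else forall x, U x -> {for x, continuous f}.

(* C^\infty on U; used for open U only *)
Definition smooth_on (X Y : normedModType R) (U : set X) (f : X -> Y) : Prop :=
  forall k, Ck k U f.

Record chart (d : nat) (M : topologicalType) := Chart {
  cdom : set M;
  cmap :> M -> 'rV[R]_d;
  cinv : 'rV[R]_d -> M;
  cdom_open : open cdom;
  cimg_open : open (cmap @` cdom);
  cinvK : forall p, cdom p -> cinv (cmap p) = p;
  cmap_cont : forall p, cdom p -> {for p, continuous cmap};
  cinv_cont : forall x, (cmap @` cdom) x -> {for x, continuous cinv} }.

Definition cimg d (M : topologicalType) (c : chart d M) : set 'rV[R]_d := c @` cdom c.

Definition compatible d (M : topologicalType) (c c' : chart d M) : Prop :=
  smooth_on (c @` (cdom c `&` cdom c')) (c' \o cinv c) /\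
  smooth_on (c' @` (cdom c `&` cdom c')) (c \o cinv c').

(* chart_at selects a chart around each point. The tangent space T_pM is 'rV_d: a
   tangent vector at p is represented by its components in the chart chart_at p. *)
Record manifold (d : nat) := Manifold {
  mcarrier :> topologicalType;
  mhausdorff : hausdorff_space mcarrier;
  msecond_countable : @second_countable mcarrier;
  atlas : set (chart d mcarrier);
  atlas_compatible : forall c c', atlas c -> atlas c' -> compatible c c';
  atlas_maximal : forall c, (forall c', atlas c' -> compatible c c') -> atlas c;
  chart_at : mcarrier -> chart d mcarrier;
  chart_at_atlas : forall p, atlas (chart_at p);
  chart_at_dom : forall p, cdom (chart_at p) p }.

Section Maps.
Context {d e : nat} {M : manifold d} {N : manifold e}.

Definition smooth_map (A : set M) (f : M -> N) : Prop :=
  (forall p, A p -> {for p, continuous f}) /\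
  forall c c', atlas c -> atlas c' ->
    smooth_on (c @` (cdom c `&` A `&` (f @^-1` cdom c'))) (c' \o f \o cinv c).

(* T_p f *)
Definition tmap (f : M -> N) (p : M) : 'Hom('rV[R]_d, 'rV[R]_e) :=
  linfun ('d (chart_at (f p) \o f \o cinv (chart_at p)) (chart_at p p)).

(* smoothness of an uncurried map on A x M2, in product charts *)
Definition smooth_map2 (d2 : nat) (M2 : manifold d2) (A : set M) (h : M -> M2 -> N) : Prop :=
  (forall p q, A p -> {for (p, q), continuous (fun z : M * M2 => h z.1 z.2)}) /\
  forall c c2 c', atlas c -> atlas c2 -> atlas c' ->
    smooth_on
      [set z : 'rV[R]_(d + d2) | exists p q,
         [/\ A p, cdom c p, cdom c2 q, cdom c' (h p q) & z = row_mx (c p) (c2 q)]]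
      (fun z => c' (h (cinv c (lsubmx z)) (cinv c2 (rsubmx z)))).

End Maps.

Section Forms.
Context {d : nat} {M : manifold d}.

(* T_p c and T_x (c^-1) for a chart c *)
Definition dchart (c : chart d M) (p : M) : 'rV[R]_d -> 'rV[R]_d :=
  'd (c \o cinv (chart_at p)) (chart_at p p).
Definition dcinv (c : chart d M) (x : 'rV[R]_d) : 'rV[R]_d -> 'rV[R]_d :=
  'd (chart_at (cinv c x) \o cinv c) x.

(* the expression of a differential form in the chart c, i.e. its pull-back by c^-1 *)
Definition local_expr m (c : chart d M) (w : M -> m.-tuple 'rV[R]_d -> R^o)
    (x : 'rV[R]_d) (u : m.-tuple 'rV[R]_d) : R^o :=
  w (cinv c x) [tuple dcinv c x (tnth u i) | i < m].

Definition smooth_form m (w : M -> m.-tuple 'rV[R]_d -> R^o) : Prop :=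
  forall c, atlas c -> forall u, smooth_on (cimg c) (fun x => local_expr c w x u).

(* exterior derivative of a form on (an open subset of) R^d *)
Definition ext_deriv m (b : 'rV[R]_d -> m.-tuple 'rV[R]_d -> R^o)
    (x : 'rV[R]_d) (u : m.+1.-tuple 'rV[R]_d) : R :=
  \sum_(i < m.+1)
    (-1) ^+ i * 'D_(tnth u i) (fun y => b y [tuple tnth u (lift i j) | j < m]) x.

Definition closed_form m (w : M -> m.-tuple 'rV[R]_d -> R^o) : Prop :=
  forall c, atlas c -> forall x u, cimg c x -> ext_deriv (local_expr c w) x u = 0.

Definition smooth_vfield (U : set M) (X : M -> 'rV[R]_d) : Prop :=
  forall c, atlas c ->
    smooth_on (c @` (cdom c `&` U)) (fun x => dchart c (cinv c x) (X (cinv c x))).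

Definition distribution (D : M -> {vspace 'rV[R]_d}) : Prop :=
  exists l : nat, forall p, exists (U : set M) (X : 'I_l -> M -> 'rV[R]_d),
    [/\ open U, U p, forall i, smooth_vfield U (X i) &
        forall q, U q -> basis_of (D q) [tuple X i q | i < l]].

End Forms.

Section Bundles.
Context {n f : nat} {M : manifold n} {F : manifold f} {P : manifold (n + f)}.

(* p |-> (proj p, tr_fib p) is a diffeomorphism of proj^-1(tr_base) onto tr_base x F
   with inverse tr_inv *)
Record local_trivialization (proj : P -> M) := LocalTrivialization {
  tr_base : set M;
  tr_fib : P -> F;
  tr_inv : M -> F -> P;
  tr_base_open : open tr_base;
  tr_fib_smooth : smooth_map (proj @^-1` tr_base) tr_fib;
  tr_inv_smooth : smooth_map2 tr_base tr_inv;
  tr_invK : forall m y, tr_base m -> proj (tr_inv m y) = m /\ tr_fib (tr_inv m y) = y;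
  tr_fibK : forall p, tr_base (proj p) -> tr_inv (proj p) (tr_fib p) = p }.

Definition fiber_bundle (proj : P -> M) : Prop :=
  smooth_map setT proj /\ forall m, exists t : local_trivialization proj, tr_base t m.

(* V_pP *)
Definition vert (proj : P -> M) (p : P) : {vspace 'rV[R]_(n + f)} := lker (tmap proj p).

Section VerticalForms.
Context (proj : P -> M) {r s : nat}.

(* sections of \bigwedge^r V^*P (x) proj^*(\bigwedge^s T^*M) *)
Definition vform :=
  forall p : P, altform r (subvs_of (vert proj p)) (altform s 'rV[R]_n R^o).
Implicit Types w : vform.

(* the scalar r-form on F obtained by restricting w to the fiber over m, identified
   with F by a trivialization, and evaluating its values in \bigwedge^s T_m^*M on
   fixed arguments t_1, ..., t_s in T_mM *)
Definition fiber_restr (t : local_trivialization proj) (m : M) w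
    (a : s.-tuple 'rV[R]_n) (y : F) (u : r.-tuple 'rV[R]_f) : R^o :=
  w (tr_inv t m y)
    [tuple vsproj (vert proj (tr_inv t m y)) (tmap (tr_inv t m) y (tnth u i)) | i < r] a.

(* the components with respect to the frames given by a trivialization, a chart c of M
   and a chart c' of F are smooth *)
Definition smooth_vform w : Prop :=
  forall (t : local_trivialization proj) (c : chart n M) (c' : chart f F)
    (a : s.-tuple 'rV[R]_n) (u : r.-tuple 'rV[R]_f), atlas c -> atlas c' ->
    smooth_on
      [set z : 'rV[R]_(n + f) |
         (c @` (cdom c `&` tr_base t)) (lsubmx z) /\ cimg c' (rsubmx z)]
      (fun z => let x := lsubmx z in
         local_expr c'
           (fiber_restr t (cinv c x) w [tuple dcinv c x (tnth a i) | i < s])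
           (rsubmx z) u).

(* d_V w = 0 *)
Definition vclosed w : Prop :=
  forall (t : local_trivialization proj) m a,
    tr_base t m -> closed_form (fiber_restr t m w a).

Definition polylagrangian (N : nat) w : Prop :=
  [/\ smooth_vform w, exists c, forall p, \dim (formker (w p)) = c, vclosed w &
      forall p, polylagrangian_at N (w p)].

Definition polypresymplectic (N : nat) w : Prop := polylagrangian N w /\ r = 2.

Definition polylagrangian_distribution (N : nat) w
    (L : P -> {vspace 'rV[R]_(n + f)}) : Prop :=
  [/\ distribution L, forall p, (L p <= vert proj p)%VS &
      forall p, polylagrangian_subspace N (w p) (linfun vsval @^-1: L p)%VS].

End VerticalForms.

Section MultilagrangianForms.
Context (proj : P -> M) {k : nat} (r N : nat).
Implicit Types w : P -> altform k.+1 'rV[R]_(n + f) R^o.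

Definition multilagrangian w : Prop :=
  [/\ smooth_form w, exists c, forall p, \dim (formker (w p)) = c, closed_form w &
      forall p, multilagrangian_at r N (vert proj p) (w p)].

Definition multipresymplectic w : Prop := [/\ multilagrangian w, k = n & r = 2].

Definition multilagrangian_distribution w (L : P -> {vspace 'rV[R]_(n + f)}) : Prop :=
  distribution L /\ forall p, multilagrangian_subspace r N (vert proj p) (w p) (L p).

Definition vsymbol (hr : (r <= k.+1)%N) w : @vform proj r (k.+1 - r) :=
  fun p => symbol (tmap proj p) hr (w p).

End MultilagrangianForms.

End Bundles.
End Smooth.
Arguments fiber_bundle {R n f M} F {P} proj.
Arguments smooth_vform {R n f M} F {P} {proj r s} w.
Arguments vclosed {R n f M} F {P} {proj r s} w.
Arguments polylagrangian {R n f M} F {P} {proj r s} N w.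
Arguments polypresymplectic {R n f M} F {P} {proj r s} N w.
Arguments manifold : clear implicits.

(* Main.v *)
(** Algebra: [(\bigwedge^m L^\perp) (x) E] is exactly the space of forms vanishing as soon
    as one argument lies in [L]. Contracting [omega] with [l \in L] therefore gives a symbol
    in [\bigwedge^(r-1) L^\perp (x) \bigwedge^(k+1-r) T^*]; conversely a decomposable element
    of that space lifts to the determinant form on [W] whose rows are the given covectors
    precomposed with a projection [W -> V] and with [W -> T], and this lift is
    [i_l omega] for some [l \in L]. A vector [w] of [ker omega] contracts every
    [i_l omega] to zero, i.e. all of [\bigwedge^k_(r-1) L^\perp], which is impossible if [w]
    is not vertical. For [r = 2], [k = n] the forms [i_w omega] with [w] in the kernel of the
    symbol vanish on [V], so they belong to the line of pull-backs of volume forms of [T].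
    The dimension of the kernel of a polylagrangian form depends only on dimensions, since
    a map [V' -> V] inducing an isomorphism [V' / L' -> V / L] pulls back
    [\bigwedge L^\perp] isomorphically; this gives the constant rank.

    Geometry: a trivialization, a chart of [M] and a chart of [F] combine into a chart of
    [P]. In it the components of the symbol are those of [omega] on vectors tangent to [F]
    followed by vectors tangent to [M]. Thus the symbol is smooth, and [d_V] of the symbol
    is [d omega] on such vectors, because the derivatives of [omega] along [M] involve
    [r + 1] vertical arguments. *)

From HB Require Import structures.
Require Import Defs.
From mathcomp Require Import all_boot all_order all_fingroup all_algebra.
From mathcomp Require Import all_classical all_reals all_analysis.
Set Implicit Arguments.
Unset Strict Implicit.
Unset Printing Implicit Defensive.
Import Order.TTheory GRing.Theory Num.Theory numFieldNormedType.Exports.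

Local Open Scope classical_set_scope.
Local Open Scope ring_scope.

(** * Alternating forms *)

Section AltForm.
Context {R : realType}.
Implicit Types (W E : lmodType R).

Lemma altform_linear m W E (f : altform m W E) u i a x y :
  f (tsubst u i (a *: x + y)) = a *: f (tsubst u i x) + f (tsubst u i y).
Proof. by have := altfunP f; rewrite inE => -[]. Qed.

Lemma altform_eq0 m W E (f : altform m W E) u i j :
  i != j -> tnth u i = tnth u j -> f u = 0.
Proof. by have := altfunP f; rewrite inE => -[_]; apply. Qed.

Lemma altformP m W E (f g : altform m W E) : (forall u, f u = g u) -> f = g.
Proof. by move=> fg; apply: val_inj; apply: funext. Qed.

Lemma altform0E m W E u : (0 : altform m W E) u = 0.
Proof. by []. Qed.

Lemma altformDE m W E (f g : altform m W E) u : (f + g) u = f u + g u.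
Proof. by []. Qed.

Lemma altformZE m W E a (f : altform m W E) u : (a *: f) u = a *: f u.
Proof. by []. Qed.

Lemma altformNE m W E (f : altform m W E) u : (- f) u = - f u.
Proof. by []. Qed.

Lemma altform_sumE m W E I (r : seq I) (f : I -> altform m W E) u :
  (\sum_(i <- r) f i) u = \sum_(i <- r) f i u.
Proof.
by elim: r => [|i r IH]; rewrite ?big_nil // !big_cons altformDE IH.
Qed.

Lemma tnth_tsubst m W (u : m.-tuple W) i x j :
  tnth (tsubst u i x) j = if j == i then x else tnth u j.
Proof. by rewrite tnth_mktuple. Qed.

Lemma tsubst_id m W (u : m.-tuple W) i : tsubst u i (tnth u i) = u.
Proof. by apply: eq_from_tnth => j; rewrite tnth_tsubst; case: eqP => [->|]. Qed.

Lemma tsubstC m W (u : m.-tuple W) i j x y : i != j ->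
  tsubst (tsubst u i x) j y = tsubst (tsubst u j y) i x.
Proof.
move=> ij; apply: eq_from_tnth => l; rewrite !tnth_tsubst.
by case: (l =P i) => [->|//]; rewrite (negPf ij).
Qed.

Lemma altform_tsubstD m W E (f : altform m W E) u i x y :
  f (tsubst u i (x + y)) = f (tsubst u i x) + f (tsubst u i y).
Proof. by have := altform_linear f u i 1 x y; rewrite !scale1r. Qed.

Lemma altform_tsubst0 m W E (f : altform m W E) u i : f (tsubst u i 0) = 0.
Proof.
have := altform_tsubstD f u i 0 0; rewrite addr0 -[LHS]addr0.
by move/addrI.
Qed.

(** Polarization: with the other slots fixed, the value at [x + y] in both slots vanishes, and
    expanding it leaves only the two mixed terms. *)
Lemma altform_tperm m W E (f : altform m W E) (u : m.-tuple W) i j : i != j ->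
  f [tuple tnth u (tperm i j l) | l < m] = - f u.
Proof.
move=> ij; set x := tnth u i; set y := tnth u j.
pose F a b := f (tsubst (tsubst u i a) j b).
have F0 a : F a a = 0.
  by apply: (altform_eq0 f ij); rewrite !tnth_tsubst !eqxx (negPf ij).
have FD a a' b : F (a + a') b = F a b + F a' b.
  by rewrite /F !(tsubstC _ _ _ ij) altform_tsubstD.
have : F (x + y) (x + y) = 0 by exact: F0.
rewrite FD /F !altform_tsubstD -/(F x x) -/(F y y) !F0 add0r addr0 => /eqP.
rewrite addrC addr_eq0 -/(F y x) -/(F x y) => /eqP Fyx.
have fu : f u = F x y by rewrite /F /x tsubst_id /y tsubst_id.
rewrite fu -Fyx; congr (altfun f _); apply: eq_from_tnth => l.
rewrite !tnth_mktuple; case: tpermP => [->|->|/eqP li /eqP lj].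
- by rewrite eqxx (negPf ij).
- by rewrite eqxx.
- by rewrite (negPf li) (negPf lj).
Qed.

Lemma contrE m W E (w : W) (f : altform m.+1 W E) (u : m.-tuple W) :
  contr w f u = f [tuple of w :: u].
Proof.
by congr (altfun f _); apply: eq_from_tnth => i; rewrite tnth_mktuple (tnth_nth 0).
Qed.

Lemma contr_linear m W E (f : altform m.+1 W E) a x y :
  contr (a *: x + y) f = a *: contr x f + contr y f.
Proof.
apply: altformP => u; rewrite altformDE altformZE !contrE.
have cE z : [tuple of z :: u] = tsubst [tuple of 0 :: u] ord0 z.
  apply: eq_from_tnth => i; rewrite tnth_tsubst.
  by case: (unliftP ord0 i) => [j ->|->]; rewrite !(tnth_nth 0).
by rewrite (cE (a *: x + y)) (cE x) (cE y) altform_linear.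
Qed.

Lemma contr0 m W E (f : altform m.+1 W E) : contr 0 f = 0.
Proof. by have := contr_linear f (-1) 0 0; rewrite scaler0 addr0 scaleN1r addNr. Qed.

Lemma contrD m W E (f : altform m.+1 W E) x y : contr (x + y) f = contr x f + contr y f.
Proof. by have := contr_linear f 1 x y; rewrite !scale1r. Qed.

Lemma contrZ m W E (f : altform m.+1 W E) a x : contr (a *: x) f = a *: contr x f.
Proof. by have := contr_linear f a x 0; rewrite contr0 !addr0. Qed.

Lemma altform_contr_eq0 m W E (f : altform m.+1 W E) :
  (forall w, contr w f = 0) -> f = 0.
Proof.
move=> f0; apply: altformP => u; rewrite altform0E.
have -> : u = [tuple of thead u :: [tuple of behead u]] by exact: tuple_eta.
by rewrite -contrE f0.
Qed.

Lemma contr_contr m W E (f : altform m.+2 W E) w : contr w (contr w f) = 0.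
Proof.
apply: altformP => u; rewrite !contrE (altform_eq0 _ (_ : ord0 != lift ord0 ord0)) //.
Qed.

End AltForm.

(** * Determinants with a zero block, and determinant forms *)

Section Det.
Context {R : realType}.

(** In the Leibniz expansion every permutation sends some index of [I] into [J], by counting, so
    every product contains a zero entry. *)
Lemma det_zero_block m (A : 'M[R]_m) (I J : {set 'I_m}) :
  (m < #|I| + #|J|)%N -> (forall i j, i \in I -> j \in J -> A i j = 0) -> \det A = 0.
Proof.
move=> mIJ A0; rewrite /determinant big1 // => s _.
have /card_gt0P [i] : (0 < #|I :&: (s^-1)%g @: J|)%N.
  have := cardsUI I ((s^-1)%g @: J).
  rewrite card_imset; last exact: perm_inj.
  move=> e; rewrite -(ltn_add2l #|I :|: (s^-1)%g @: J|) addn0 e.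
  by apply: leq_ltn_trans mIJ; rewrite -[X in (_ <= X)%N]card_ord max_card.
rewrite inE => /andP [iI /imsetP [j jJ ij]].
by rewrite (bigD1 i) //= ij permKV -ij A0 // mul0r mulr0.
Qed.

Lemma det_block_diag k a b (e : k = (a + b)%N) (M : 'M[R]_k) (A : 'M[R]_a) (B : 'M[R]_b) :
  (forall i j, M (cast_ord (esym e) (lshift b i)) (cast_ord (esym e) (lshift b j)) = A i j) ->
  (forall i j, M (cast_ord (esym e) (rshift a i)) (cast_ord (esym e) (rshift a j)) = B i j) ->
  (forall i j, M (cast_ord (esym e) (rshift a i)) (cast_ord (esym e) (lshift b j)) = 0) ->
  \det M = \det A * \det B.
Proof.
subst k => MA MB M0.
have -> : M = block_mx A (ursubmx M) 0 B.
  rewrite -[LHS]submxK; congr block_mx; apply/matrixP => i j.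
  - by rewrite -MA !mxE; congr (M _ _); apply: val_inj.
  - by rewrite !mxE -[RHS](M0 i j); congr (M _ _); apply: val_inj.
  - by rewrite -MB !mxE; congr (M _ _); apply: val_inj.
exact: det_ublock.
Qed.
End Det.

Section DetForm.
Context {R : realType}.
Implicit Types (W : vectType R) (E : lmodType R).

Lemma detform_subproof m W E (a : 'I_m -> 'Hom(W, R^o)) (e : E) :
  (fun u : m.-tuple W => \det (\matrix_(i, j) (a i (tnth u j) : R)) *: e)
    \in alternating_pred m W E.
Proof.
rewrite inE; split=> [u i c x y|u i j ij uij].
  rewrite scalerA -scalerDl; congr (_ *: _).
  pose M (v : m.-tuple W) := \matrix_(p, q) (a p (tnth v q) : R).
  have := @determinant_multilinear _ _ (M (tsubst u i (c *: x + y)))^T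
    (M (tsubst u i x))^T (M (tsubst u i y))^T i c 1.
  rewrite !det_tr mul1r; apply.
  - apply/rowP => j; rewrite !mxE !tnth_tsubst eqxx linearP !mul1r.
    by [].
  - by apply/matrixP => j l; rewrite !mxE !tnth_tsubst eq_sym (negPf (neq_lift _ _)).
  - by apply/matrixP => j l; rewrite !mxE !tnth_tsubst eq_sym (negPf (neq_lift _ _)).
rewrite -det_tr (@determinant_alternate _ _ _ i j) ?scale0r // => l.
by rewrite !mxE uij.
Qed.

Definition detform m W E (a : 'I_m -> 'Hom(W, R^o)) (e : E) : altform m W E :=
  AltForm (detform_subproof a e).

Lemma detformE m W E (a : 'I_m -> 'Hom(W, R^o)) (e : E) u :
  detform a e u = \det (\matrix_(i, j) (a i (tnth u j) : R)) *: e.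
Proof. by []. Qed.

(** The left-hand form is [b] wedged with the [a i]. The first column of its matrix is [b w]
    followed by zeros, and expansion along it gives the claim. *)
Lemma detform_cons m W E (b : 'Hom(W, R^o)) (a : 'I_m -> 'Hom(W, R^o)) (e : E) w (u : m.-tuple W) :
  (forall i, a i w = 0) ->
  detform (fun i => if unlift ord0 i is Some j then a j else b) e [tuple of w :: u] =
  (b w : R) *: detform a e u.
Proof.
move=> aw; rewrite !detformE scalerA; congr (_ *: _).
rewrite (expand_det_col _ ord0) big_ord_recl /= big1 ?addr0.
  rewrite mxE unlift_none /= /cofactor /= expr0 mul1r; congr (_ * \det _).
  by apply/matrixP => i j; rewrite !mxE liftK (tnth_nth 0) /= -tnth_nth.
by move=> i _; rewrite mxE liftK (tnth_nth 0) /= aw mul0r.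
Qed.

(** The line through [v] meets [L] only in 0, so one can project onto it along [L] and take the
    coordinate with respect to [v]. *)
Lemma covector_exists W (L : {vspace W}) v : v \notin L ->
  exists b : 'Hom(W, R^o), (L <= lker b)%VS /\ b v = 1.
Proof.
move=> vL.
have vL0 : (<[v]> :&: L = 0)%VS.
  apply/eqP; rewrite -subv0; apply/subvP => x; rewrite memv_cap memv0.
  move=> /andP[/vlineP[c ->]] cvL; apply: contraNT vL => cv0.
  have c0 : c != 0 by apply: contraNneq cv0 => ->; rewrite scale0r.
  by rewrite -[v](scalerK c0) rpredZ.
have v0 : v != 0 by apply: contraNneq vL => ->; rewrite rpred0.
have fv : free [tuple v] by rewrite seq1_free.
exists (linfun (coord [tuple v] ord0) \o daddv_pi <[v]> L)%VF; split.
  apply/subvP => x xL; rewrite memv_ker comp_lfunE.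
  have xL' : daddv_pi L <[v]> x = x by apply: daddv_pi_id; rewrite // capvC.
  have /eqP := daddv_pi_add vL0 (subvP (addvSr <[v]> L) _ xL).
  by rewrite xL' -subr_eq0 addrK => /eqP ->; rewrite linear0.
rewrite comp_lfunE daddv_pi_id ?memv_line // lfunE /=.
exact: (coord_free ord0 ord0 fv).
Qed.

End DetForm.

(** * Exterior powers of an annihilator as spaces of vanishing forms *)

Section ExtAnnihilator.
Context {R : realType}.
Implicit Types (W : vectType R) (E : lmodType R).

(** The intrinsic description of [ext_annihilator], as [ext_annihilatorP] proves; in degree 0 it is
    no condition. *)
Definition vanishes m W E (L : {vspace W}) (f : altform m W E) : Prop :=
  forall u i, tnth u i \in L -> f u = 0.

Lemma vanishesP m W E (L : {vspace W}) (f : altform m.+1 W E) :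
  vanishes L f <-> forall l, l \in L -> contr l f = 0.
Proof.
split=> [fL l lL|fL u i ui].
  by apply: altformP => u; rewrite contrE (fL _ ord0).
(* A transposition brings the argument lying in [L] to the first slot, at the cost of a sign. *)
suff tL (t : m.+1.-tuple W) : tnth t ord0 \in L -> f t = 0.
  have [i0|i0] := eqVneq i ord0; first by apply: tL; rewrite -i0.
  apply/eqP; rewrite -oppr_eq0 -(altform_tperm _ _ i0); apply/eqP/tL.
  by rewrite tnth_mktuple tpermR.
move=> t0; have -> : t = [tuple of thead t :: [tuple of behead t]] by exact: tuple_eta.
by rewrite -contrE fL.
Qed.

Lemma vanishes_contr m W E (L : {vspace W}) (f : altform m.+1 W E) w :
  vanishes L f -> vanishes L (contr w f).
Proof.
move=> fL u i ui; rewrite contrE (fL _ (lift ord0 i)) //.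
by rewrite (tnth_nth 0) /= -tnth_nth.
Qed.

Lemma vanishes_add_line m W E (L : {vspace W}) (f : altform m.+1 W E) w :
  vanishes L f -> contr w f = 0 -> vanishes (L + <[w]>) f.
Proof.
move=> /vanishesP fL fw; apply/vanishesP => _ /memv_addP[l lL [_ /vlineP[c ->] ->]].
by rewrite contrD contrZ fw scaler0 addr0 fL.
Qed.

(** A second contraction with [w] gives zero, so [i_w f] even descends to the quotient by [L +
    <[w]>]. This drives the inductions that enlarge [L]. *)
Lemma vanishes_contr_line m W E (L : {vspace W}) (f : altform m.+1 W E) w :
  vanishes L f -> vanishes (L + <[w]>) (contr w f).
Proof.
case: m f => [|m] f fL; first by move=> u [].
by apply: vanishes_add_line; [exact: vanishes_contr|exact: contr_contr].
Qed.

(** Such a form lives on the quotient by [L], whose dimension is below the degree. Contraction with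
    [w] outside [L] lowers codimension and degree together. *)
Lemma vanishes_eq0 m W E (L : {vspace W}) (f : altform m W E) :
  vanishes L f -> (\dim {:W} < \dim L + m)%N -> f = 0.
Proof.
elim: m L f => [|m IH] L f fL dL.
  by move: dL; rewrite addn0 ltnNge dimvS // subvf.
apply: altform_contr_eq0 => w; have [wL|wL] := boolP (w \in L).
  by move/vanishesP: fL; exact.
apply: (IH (L + <[w]>)%VS); first exact: vanishes_contr_line.
apply: leq_trans dL _; rewrite addnS ltn_add2r.
rewrite (ltn_leqif (dimv_leqif_sup (addvSl L <[w]>))).
by apply: contra wL => h; rewrite memvE (subv_trans (addvSr L _) h).
Qed.

Lemma vanishes_ext_annihilator m W E (L : {vspace W}) (f : altform m W E) :
  ext_annihilator L f -> vanishes L f.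
Proof.
move=> [q [a [e [aL fE]]]] u i ui; rewrite fE big1 // => c _.
rewrite (expand_det_col _ i) big1 ?scale0r // => j _; rewrite mxE.
by have /subvP/(_ _ ui) := aL c j; rewrite memv_ker => /eqP ->; rewrite mul0r.
Qed.

Lemma ext_annihilator0 m W E (L : {vspace W}) : ext_annihilator L (0 : altform m W E).
Proof.
exists 1%N, (fun _ _ => 0), (fun=> 0); split=> [c i|u].
  by apply/subvP => x _; rewrite memv_ker zero_lfunE.
by rewrite big_ord1 scaler0.
Qed.

Lemma ext_annihilatorS m W E (K L : {vspace W}) (f : altform m W E) :
  (K <= L)%VS -> ext_annihilator L f -> ext_annihilator K f.
Proof.
move=> KL [q [a [e [aL fE]]]]; exists q, a, e; split=> // c i.
exact: subv_trans (aL c i).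
Qed.

Lemma ext_annihilatorD m W E (L : {vspace W}) (f g : altform m W E) :
  ext_annihilator L f -> ext_annihilator L g -> ext_annihilator L (f + g).
Proof.
move=> [q [a [e [aL fE]]]] [q' [a' [e' [aL' gE]]]].
exists (q + q')%N, (fun c => match fintype.split c with inl c => a c | inr c => a' c end),
  (fun c => match fintype.split c with inl c => e c | inr c => e' c end); split=> [c i|u].
  by case: fintype.split => ?.
rewrite altformDE fE gE big_split_ord /=; congr (_ + _); apply: eq_bigr => c _.
  by rewrite (unsplitK (inl c)).
by rewrite (unsplitK (inr c)).
Qed.

Lemma ext_annihilator_detform m W E (L : {vspace W}) a (e : E) :
  (forall i, (L <= lker (a i))%VS) -> ext_annihilator L (detform a e : altform m W E).
Proof.
by move=> aL; exists 1%N, (fun=> a), (fun=> e); split=> // u; rewrite big_ord1.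
Qed.

Lemma ext_annihilator_sum m W E (L : {vspace W}) q (f : 'I_q -> altform m W E) :
  (forall c, ext_annihilator L (f c)) -> ext_annihilator L (\sum_(c < q) f c).
Proof.
move=> fL; elim/big_ind: _ => //; first exact: ext_annihilator0.
exact: ext_annihilatorD.
Qed.

(** The converse goes by induction on the codimension of [L]. Take [w] outside [L] and [b] vanishing
    on [L] with [b w = 1]. By induction [i_w f] is a sum of decomposables; wedging them with [b]
    gives [h]. Then [f - h] is killed by [L] and by [w], so induction applies to it as well. *)
Lemma ext_annihilatorP m W E (L : {vspace W}) (f : altform m W E) :
  ext_annihilator L f <-> vanishes L f.
Proof.
split; first exact: vanishes_ext_annihilator.
have [d] := ubnP (\dim {:W} - \dim L)%N; elim: d => // d IH in m L f *.
rewrite ltnS => dL fL.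
case: m => [|m] in f fL *.
  (* In degree 0 the empty determinant is 1, so the form is a single term whose coefficient is its
     only value. *)
  pose a0 (i : 'I_0) : 'Hom(W, R^o) := 0.
  have -> : f = detform a0 (f [tuple]).
    by apply: altformP => u; rewrite detformE det_mx00 scale1r (tuple0 u).
  by apply: ext_annihilator_detform; case.
have [L1|] := boolP ({:W} <= L)%VS.
  suff -> : f = 0 by exact: ext_annihilator0.
  apply: (vanishes_eq0 fL); rewrite (_ : L = fullv) ?addnS ?ltnS ?leq_addr //.
  by apply/eqP; rewrite eqEsubv subvf.
move=> /subvPn[w _ wL].
have dLw : (\dim {:W} - \dim (L + <[w]>) < d)%N.
  apply: leq_trans dL; apply: ltn_sub2l.
    rewrite (ltn_leqif (dimv_leqif_sup (subvf L))).
    by apply: contra wL => /subvP/(_ _ (memvf w)).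
  rewrite (ltn_leqif (dimv_leqif_sup (addvSl L <[w]>))).
  by apply: contra wL => h; rewrite memvE (subv_trans (addvSr L _) h).
have [b [bL bw]] := covector_exists wL.
have [q [a [e [aL gE]]]] := IH _ _ _ dLw (vanishes_contr_line fL (w := w)).
pose h := \sum_(c < q) detform
  (fun i => if unlift ord0 i is Some j then a c j else b) (e c).
have hL : ext_annihilator L h.
  apply: ext_annihilator_sum => c; apply: ext_annihilator_detform => i.
  by case: unlift => // j; exact: subv_trans (addvSl _ _) (aL c j).
rewrite -[f](subrK h); apply: (ext_annihilatorD _ hL).
apply: (ext_annihilatorS (addvSl L <[w]>)); apply: (IH _ _ _ dLw).
apply: vanishes_add_line.
  move=> u i ui; rewrite altformDE altformNE (fL _ i) //.
  by rewrite (vanishes_ext_annihilator hL ui) subr0.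
apply: altformP => u; rewrite contrE altformDE altformNE -contrE gE altform0E.
rewrite /h altform_sumE; apply/eqP; rewrite subr_eq0; apply/eqP.
apply: eq_bigr => c _; rewrite detform_cons ?bw ?scale1r // => i.
have /subvP/(_ w) := aL c i; rewrite memv_ker => h'; apply/eqP/h'.
by rewrite (subvP (addvSr L _)) // memv_line.
Qed.

End ExtAnnihilator.

Section AltFormCongr.
Context {R : realType}.
Implicit Types (W E : lmodType R).

Lemma altform_congr m W E (f : altform m W E) (x y : m.-tuple W) :
  (forall i (z : m.-tuple W), (forall j, tnth z j = tnth x j \/ tnth z j = tnth y j) ->
    f (tsubst z i (tnth y i - tnth x i)) = 0) -> f x = f y.
Proof.
(* [mix j] takes its first [j] entries from [y] and the others from [x]; consecutive tuples differ
   in one slot, where the hypothesis applies. *)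
move=> xy0; pose mix j := [tuple if (i < j)%N then tnth y i else tnth x i | i < m].
suff mixE j : (j <= m)%N -> f (mix j) = f x.
  rewrite -(mixE m) //; congr (altfun f _); apply: eq_from_tnth => i.
  by rewrite tnth_mktuple ltn_ord.
elim: j => [_|j IH jm].
  by congr (altfun f _); apply: eq_from_tnth => i; rewrite tnth_mktuple.
rewrite -IH 1?ltnW //; pose i := Ordinal jm.
have -> : mix j.+1 = tsubst (mix j) i (tnth x i + (tnth y i - tnth x i)).
  apply: eq_from_tnth => l; rewrite addrC subrK !tnth_mktuple ltnS leq_eqVlt -val_eqE /=.
  by have [lj|//] := eqVneq (l : nat) j; congr tnth; apply: val_inj.
rewrite altform_tsubstD [X in _ + X]xy0 ?addr0; last first.
  by move=> l; rewrite tnth_mktuple; case: ifP; [right|left].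
have -> : tnth x i = tnth (mix j) i by rewrite tnth_mktuple /= ltnn.
by rewrite tsubst_id.
Qed.

(** Expanding the double contraction of [f] with [v + w], which is zero, leaves only this term. *)
Lemma contr_contr_eq0 m W E (f : altform m.+2 W E) v w :
  contr w f = 0 -> contr w (contr v f) = 0.
Proof.
move=> wf; have /eqP := contr_contr f (v + w).
rewrite contrD wf addr0 contrD contr_contr add0r => /eqP.
exact.
Qed.

End AltFormCongr.

(** * Decomposable forms with a prescribed non-zero value *)

Section Witness.
Context {R : realType}.
Implicit Types (W : vectType R) (E : lmodType R).

(** This yields a decomposable form that is non-zero on a tuple starting with [v]. The subspaces may
    vary with [i], so that some factors can kill all vertical vectors and the others only a smaller
    subspace. *)
Lemma dual_vectors m W (K : 'I_m.+1 -> {vspace W}) v :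
  v \notin K ord0 -> (forall i : 'I_m.+1, (\dim (K i) + i < \dim {:W})%N) ->
  exists (a : 'I_m.+1 -> 'Hom(W, R^o)) (u : m.-tuple W),
    (forall i, (K i <= lker (a i))%VS) /\
    \det (\matrix_(i, j) (a i (tnth [tuple of v :: u] j) : R)) = 1.
Proof.
elim: m => [|m IH] in K v *; move=> vK dK; have [b [bK bv]] := covector_exists vK.
  exists (fun=> b), [tuple]; split; first by move=> i; rewrite (ord1 i).
  by rewrite det_mx11 mxE (tnth_nth 0).
(* Adding [v] makes the later covectors kill [v], so the first column becomes (1, 0, ..., 0). The
   shift of the index pays for the extra dimension. *)
pose K' i := (K (lift ord0 i) + <[v]>)%VS.
have dK' i : (\dim (K' i) + i < \dim {:W})%N.
  apply: leq_ltn_trans (dK (lift ord0 i)); rewrite lift0 addnS -addSn leq_add2r.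
  apply: leq_trans (dimv_add_leqif _ _) _; by rewrite -[X in (_ <= X)%N]addn1 leq_add2l dim_vline leq_b1.
have /subvPn [v' _ v'K] : ~~ ({:W} <= K' ord0)%VS.
  by apply/negP => /dimvS; rewrite leqNgt -[X in (X < _)%N]addn0 dK'.
have [a [u [aK au]]] := IH K' v' v'K dK'.
exists (fun i => if unlift ord0 i is Some j then a j else b), [tuple of v' :: u]; split.
  move=> i; case: unliftP => [j ->|->//].
  exact: subv_trans (addvSl _ _) (aK j).
have av i : a i v = 0.
  apply/eqP; rewrite -memv_ker; apply: (subvP (aK i)).
  by rewrite (subvP (addvSr _ _)) ?memv_line.
have := detform_cons b (1 : R^o) [tuple of v' :: u] av.
by rewrite !detformE au bv !scale1r /GRing.scale /= !mulr1.
Qed.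

Lemma vanishes_nonzero m W E (L : {vspace W}) (e : E) :
  e != 0 -> (\dim L + m <= \dim {:W})%N ->
  exists2 g : altform m W E, vanishes L g & g != 0.
Proof.
move=> e0; case: m => [|m] dL.
  pose a0 (i : 'I_0) : 'Hom(W, R^o) := 0.
  exists (detform a0 e); first by move=> u [].
  apply/eqP => /(congr1 (fun f : altform 0 W E => f [tuple])).
  by rewrite detformE det_mx00 scale1r altform0E; exact/eqP.
have dLi (i : 'I_m.+1) : (\dim L + i < \dim {:W})%N.
  by apply: leq_trans dL; rewrite ltn_add2l ltn_ord.
have /subvPn [v _ vL] : ~~ ({:W} <= L)%VS.
  by apply/negP => /dimvS; rewrite leqNgt -[X in (X < _)%N]addn0 (dLi ord0).
have [a [u [aL au]]] := dual_vectors (K := fun=> L) vL dLi.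
exists (detform a e); first exact/ext_annihilatorP/ext_annihilator_detform.
apply/eqP => /(congr1 (fun f : altform m.+1 W E => f [tuple of v :: u])).
by rewrite detformE au scale1r altform0E; exact/eqP.
Qed.

(** These are the top-degree forms on the quotient by [L], so a fixed basis of a complement of [L]
    detects them; [u] is built as such a basis. *)
Lemma vanishes_top_form m W (L : {vspace W}) : (\dim L + m = \dim {:W})%N ->
  exists u : m.-tuple W, forall E (g : altform m W E), vanishes L g -> g u = 0 -> g = 0.
Proof.
elim: m L => [|m IH] L dL.
  exists [tuple] => E g _ g0; apply: altformP => u.
  by rewrite (tuple0 u) g0.
have /subvPn [w _ wL] : ~~ ({:W} <= L)%VS.
  by apply/negP => /dimvS; rewrite leqNgt -dL -[X in (X < _)%N]addn0 ltn_add2l.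
have dLw : \dim (L + <[w]>) = (\dim L).+1.
  rewrite dimv_disjoint_sum ?dim_vline.
    by rewrite (_ : w != 0) ?addn1 //; apply: contraNneq wL => ->; rewrite rpred0.
  apply/eqP; rewrite -subv0; apply/subvP => x; rewrite memv_cap memv0.
  move=> /andP[xL /vlineP[c xc]]; apply: contraNT wL; rewrite xc => cw0.
  have c0 : c != 0 by apply: contraNneq cw0 => ->; rewrite scale0r.
  by rewrite -[w](scalerK c0) rpredZ // -xc.
have [|u uP] := IH (L + <[w]>)%VS; first by rewrite dLw addSnnS.
exists [tuple of w :: u] => E g gL; rewrite -contrE => gu.
have gw : contr w g = 0 by apply: uP => //; exact: vanishes_contr_line.
apply: (vanishes_eq0 (vanishes_add_line gL gw)).
by rewrite dLw -dL addSn ltnS.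
Qed.

End Witness.

(** * Kernels of polylagrangian forms *)

Section PolylagrangianRank.
Context {R : realType}.
Implicit Types (V : vectType R) (E : lmodType R).

(** The bound [r <= N] makes the space of the contractions with [L] non-zero. *)
Lemma polylagrangian_subspace_neq0 r N V E (f : altform r.+1 V E) (L : {vspace V}) (e : E) :
  polylagrangian_subspace N f L -> e != 0 -> (r <= N)%N -> f != 0.
Proof.
move=> [dL fL] e0 rN.
have [|g /ext_annihilatorP gL g0] := vanishes_nonzero (m := r) (L := L) e0.
  by rewrite dL leq_add2l.
apply: contraNneq g0 => f0.
have : ext_annihilator L g by [].
rewrite -fL => -[l _ <-]; rewrite f0.
by apply/eqP/altformP => u; rewrite contrE.
Qed.

(** A vector [v] of the kernel contracts every [i_l f] to zero, hence every form in
    [ext_annihilator L]. If [v] lay outside [L], some decomposable one would have a non-zero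
    contraction with it. *)
Lemma formker_polylagrangian r N V E (f : altform r.+2 V E) (L : {vspace V}) (e : E) :
  polylagrangian_subspace N f L -> e != 0 -> (r < N)%N -> (formker f <= L)%VS.
Proof.
move=> [dL fL] e0 rN; apply/subvP => v /mem_formker vf.
have {}vf : contr v f = 0 by exact: vf.
apply: contraT => vL.
have [|a [u [aL au]]] := dual_vectors (m := r) (K := fun=> L) vL.
  by move=> i; rewrite dL ltn_add2l (leq_ltn_trans _ rN) // -ltnS.
have : ext_annihilator L (detform a e) by exact: ext_annihilator_detform.
rewrite -fL => -[l _ fl].
have : contr v (detform a e) u = 0 by rewrite -fl contr_contr_eq0.
by rewrite contrE detformE au scale1r => /eqP; rewrite (negPf e0).
Qed.

Lemma pullback_subproof m V V' E (h : 'Hom(V', V)) (f : altform m V E) :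
  (fun u : m.-tuple V' => f [tuple h (tnth u i) | i < m]) \in alternating_pred m V' E.
Proof.
have := altfunP f; rewrite !inE => fP.
apply: (alternating_comp (l := h) (pos := id) fP) => //.
- exact: linearP.
- move=> u i x; apply: eq_from_tnth => j; rewrite !tnth_mktuple.
  by case: eqP.
- by move=> u i; rewrite tnth_mktuple.
Qed.

Definition pullback m V V' E (h : 'Hom(V', V)) (f : altform m V E) : altform m V' E :=
  AltForm (pullback_subproof h f).

Lemma pullback_linear m V V' E (h : 'Hom(V', V)) a (f g : altform m V E) :
  pullback h (a *: f + g) = a *: pullback h f + pullback h g.
Proof. exact: altformP. Qed.

(** Modulo [L] every argument is in the image of [h], and [g] does not see the components in [L]. *)
Lemma pullback_eq0 m V V' E (h : 'Hom(V', V)) (L : {vspace V}) (g : altform m V E) :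
  (limg h + L)%VS = fullv -> vanishes L g -> pullback h g = 0 -> g = 0.
Proof.
move=> hL gL hg; apply: altformP => u.
have uP i : exists x, tnth u i - h x \in L.
  have : tnth u i \in (limg h + L)%VS by rewrite hL memvf.
  move=> /memv_addP[_ /memv_imgP[x _ ->] [l lL ->]].
  by exists x; rewrite addrC addKr.
pose x := [tuple xget 0 [set x | tnth u i - h x \in L] | i < m].
have xP i : tnth u i - h (tnth x i) \in L.
  rewrite tnth_mktuple; case: xgetP => [_ -> //|no].
  by have [y /(no y)] := uP i.
have hgx : pullback h g x = 0 by rewrite hg.
rewrite altform0E -[RHS]hgx.
apply: altform_congr => i z _; apply: (gL _ i).
by rewrite tnth_tsubst eqxx [tnth [tuple _ | _ < _] i]tnth_mktuple -opprB rpredN xP.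
Qed.

(** Complements of [L'] and of [L] both have dimension [N]; [h] kills [L'] and matches bases of the
    complements. *)
Lemma complement_map N V V' (L : {vspace V}) (L' : {vspace V'}) :
  \dim {:V} = (\dim L + N)%N -> \dim {:V'} = (\dim L' + N)%N ->
  exists h : 'Hom(V', V), (L' <= lker h)%VS /\ (limg h + L)%VS = fullv.
Proof.
move=> dL dL'.
have dC (U : vectType R) (K : {vspace U}) : \dim {:U} = (\dim K + N)%N ->
    size (vbasis K^C) = N.
  by move=> dK; rewrite size_tuple dimv_compl dK addKn.
have [g gP] := linear_of_free (vbasis L'^C) (vbasis L^C).
have {}gP : map g (vbasis L'^C) = vbasis L^C.
  by apply: gP; [exact: basis_free (vbasisP _)|rewrite !(dC _ L, dC _ L')].
have disj : (L'^C :&: L' = 0)%VS by rewrite capvC capv_compl.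
exists (linfun g \o daddv_pi L'^C L')%VF; split.
  apply/subvP => x xL'; rewrite memv_ker comp_lfunE.
  have x0 : daddv_pi L' L'^C x = x by apply: daddv_pi_id; rewrite // capvC.
  have /eqP := daddv_pi_add disj (subvP (addvSr _ _) _ xL').
  by rewrite x0 -subr_eq0 addrK => /eqP ->; rewrite linear0.
apply/eqP; rewrite eqEsubv subvf /= -(addv_complf L) addvC addvS //.
rewrite -{1}(span_basis (vbasisP L^C)); apply/span_subvP => x; rewrite -gP.
move=> /mapP[y yL ->]; have -> : g y = (linfun g \o daddv_pi L'^C L')%VF y.
  by rewrite comp_lfunE lfunE daddv_pi_id // (basis_mem (vbasisP _)).
by rewrite memv_img ?memvf.
Qed.

(** The difference [\dim K - \dim (formker f)] measures the size of [ext_annihilator L]. Pull-back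
    along a map of complements embeds this space into [ext_annihilator L'], which gives one
    inequality between the two differences. *)
Lemma formker_rank_le r V V' E (f : altform r.+1 V E) (f' : altform r.+1 V' E)
    (K : {vspace V}) (K' : {vspace V'}) (L : {vspace V}) (L' : {vspace V'}) N :
  \dim {:V} = (\dim L + N)%N -> \dim {:V'} = (\dim L' + N)%N ->
  (formker f <= K)%VS -> (formker f' <= K')%VS ->
  [set contr x f | x in [set` K]] = ext_annihilator L ->
  [set contr x f' | x in [set` K']] = ext_annihilator L' ->
  (\dim K + \dim (formker f') <= \dim K' + \dim (formker f))%N.
Proof.
move=> dL dL' kK kK' fL fL'; have [h [hL' hL]] := complement_map dL dL'.
have xP x : x \in K -> exists x', x' \in K' /\ contr x' f' = pullback h (contr x f).
  move=> xK; have : ext_annihilator L' (pullback h (contr x f)).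
    apply/ext_annihilatorP => u i ui.
    suff /ext_annihilatorP xf : ext_annihilator L (contr x f).
      apply: (xf _ i); rewrite tnth_mktuple.
      by have /subvP/(_ _ ui) := hL'; rewrite memv_ker => /eqP ->; rewrite rpred0.
    by rewrite -fL; exists x.
  by rewrite -fL' => -[x' x'K' <-]; exists x'.
pose C := (K :\: formker f)%VS.
have CK : (C <= K)%VS by exact: diffvSl.
(* [y] chooses a vector representing the pulled-back contraction; it need not be linear, so [g]
   below extends its values on a basis of [C]. *)
pose y x := xget 0 [set x' | x' \in K' /\ contr x' f' = pullback h (contr x f)].
have yP x : x \in K -> y x \in K' /\ contr (y x) f' = pullback h (contr x f).
  by move=> /xP xx'; rewrite /y; case: xgetP => [_ -> //|no]; have [x' /no] := xx'.
have [g gP] := linear_of_free (vbasis C) (map y (vbasis C)).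
have {}gP : {in vbasis C, forall x, g x = y x}.
  by apply/eq_in_map; apply: gP; [exact: basis_free (vbasisP _)|rewrite size_map].
have gK x : x \in C -> g x \in K'.
  move=> xC; rewrite (coord_vbasis xC) linear_sum rpred_sum // => i _.
  rewrite linearZ rpredZ //= gP ?mem_nth ?size_tuple //.
  apply: (yP _ _).1; apply: (subvP CK); apply: vbasis_mem.
  by rewrite mem_nth ?size_tuple.
have gC x : x \in C -> contr (g x) f' = pullback h (contr x f).
  move=> xC; rewrite (coord_vbasis xC).
  elim/big_rec: _ => [|i z _ IH].
    by rewrite linear0 !contr0; apply: altformP.
  rewrite linearP !contr_linear pullback_linear IH gP ?mem_nth ?size_tuple //.
  rewrite (yP _ _).2 //; apply: (subvP CK); apply: vbasis_mem.
  by rewrite mem_nth ?size_tuple.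
(* Thus [g] is injective on [C] even modulo the kernel of [f']: the pull-back loses nothing, and [C]
   meets the kernel of [f] only in 0. *)
have Cker x : x \in C -> contr (g x) f' = 0 -> x = 0.
  move=> xC; rewrite gC // => /(pullback_eq0 hL) xf0.
  suff : x \in (C :&: formker f)%VS by rewrite capv_diff memv0 => /eqP.
  rewrite memv_cap xC; apply/mem_formker => //; apply: xf0; apply/ext_annihilatorP.
  by rewrite -fL; exists x => //; exact: (subvP CK).
have dC : (\dim K = \dim C + \dim (formker f))%N.
  by rewrite -dimv_disjoint_sum ?capv_diff // addv_diff (addv_idPl kK).
have dgC : \dim (linfun g @: C) = \dim C.
  apply: limg_dim_eq; apply/eqP; rewrite -subv0; apply/subvP => x.
  rewrite memv_cap memv_ker lfunE memv0 => /andP[xC /eqP gx].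
  by apply/eqP/Cker => //; rewrite [g x]gx contr0.
rewrite dC addnAC leq_add2r -dgC -dimv_disjoint_sum; last first.
  apply/eqP; rewrite -subv0; apply/subvP => x; rewrite memv_cap memv0.
  move=> /andP[/memv_imgP[z zC ->]]; rewrite lfunE => /mem_formker gz.
  by rewrite [z]Cker ?linear0 //; exact: gz.
apply: dimvS; rewrite subv_add kK' andbT; apply/subvP => _ /memv_imgP[z zC ->].
by rewrite lfunE gK.
Qed.

End PolylagrangianRank.

(** * The symbol of a multilagrangian form *)

Section Subvs.
Context {R : realType} {W : vectType R} (V : {vspace W}).
Implicit Types (L : {vspace W}).

Lemma linfun_vsval (x : subvs_of V) : (linfun vsval : 'Hom(subvs_of V, W)) x = vsval x.
Proof. by rewrite lfunE. Qed.

Lemma mem_lpreim_vsval L (x : subvs_of V) : (x \in linfun vsval @^-1: L)%VS = (vsval x \in L).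
Proof. by rewrite -memv_preim linfun_vsval. Qed.

Lemma lker_linfun_vsval : lker (linfun vsval : 'Hom(subvs_of V, W)) = 0%VS.
Proof. by apply/eqP/lker0P => x y; rewrite !linfun_vsval => /val_inj. Qed.

Lemma dim_img_vsval (K : {vspace subvs_of V}) : \dim (linfun vsval @: K) = \dim K.
Proof. by rewrite limg_dim_eq // lker_linfun_vsval capv0. Qed.

Lemma limg_vsval : limg (linfun vsval : 'Hom(subvs_of V, W)) = V.
Proof.
apply/vspaceP => x; apply/memv_imgP/idP => [[y _ ->]|xV].
  by rewrite linfun_vsval subvsP.
by exists (vsproj V x); rewrite ?memvf // linfun_vsval vsprojK.
Qed.

Lemma dim_subvs : \dim {:subvs_of V} = \dim V.
Proof. by rewrite -dim_img_vsval limg_vsval. Qed.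

Lemma dim_lpreim_vsval L : (L <= V)%VS -> \dim (linfun vsval @^-1: L : {vspace subvs_of V})%VS = \dim L.
Proof. by move=> LV; rewrite -dim_img_vsval lpreimK // limg_vsval. Qed.

End Subvs.

(** * Horizontal forms *)

Section Horizontal.
Context {R : realType}.
Implicit Types (W : vectType R).

(** The vertical argument in slot [j] is transposed into slot [s], where the definition of
    [horizontal] expects it. *)
Lemma horizontal_pos s m W (V : {vspace W}) (f : altform m W R^o) (u : m.-tuple W) (j : 'I_m) :
  horizontal s V f -> (s <= j)%N -> (forall i : 'I_m, (i < s)%N -> tnth u i \in V) ->
  tnth u j \in V -> f u = 0.
Proof.
move=> fV sj uV ujV; have sm := leq_ltn_trans sj (ltn_ord j).
have [sj'|sj'] := eqVneq (Ordinal sm) j.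
  apply: fV => // i; rewrite leq_eqVlt => /orP[/eqP is_|]; last exact: uV.
  by have -> : i = j by rewrite -sj'; apply: val_inj.
apply/eqP; rewrite -oppr_eq0 -(altform_tperm _ _ sj'); apply/eqP/fV => // i.
rewrite tnth_mktuple leq_eqVlt => /orP[/eqP is_|i_s].
  by rewrite (_ : i = Ordinal sm) ?tpermL //; apply: val_inj.
rewrite tpermD ?uV //; apply: contraTneq i_s => <-; rewrite -leqNgt //=.
Qed.

(** This is the independence of the splitting: beside [s] vertical arguments, a vertical change of
    any other argument contributes zero. *)
Lemma horizontal_congr s m W (V : {vspace W}) (f : altform m W R^o) (x y : m.-tuple W) :
  horizontal s V f ->
  (forall i : 'I_m, (i < s)%N -> tnth x i = tnth y i /\ tnth x i \in V) ->
  (forall i, tnth y i - tnth x i \in V) -> f x = f y.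
Proof.
move=> fV xyV xy; apply: altform_congr => i z zxy.
have [i_s|i_s] := ltnP i s; first by rewrite (xyV i i_s).1 subrr altform_tsubst0.
apply: (horizontal_pos fV i_s); last by rewrite tnth_tsubst eqxx.
move=> j js; rewrite tnth_tsubst ifF; last first.
  by apply: contraTF js => /eqP ->; rewrite -leqNgt.
by have [e xV] := xyV j js; case: (zxy j) => ->; rewrite // -e.
Qed.

Lemma horizontalD m s W (V : {vspace W}) (f g : altform m W R^o) :
  horizontal s V f -> horizontal s V g -> horizontal s V (f + g).
Proof. by move=> fV gV sm u uV; rewrite altformDE fV ?gV ?addr0. Qed.

End Horizontal.

(** * Polylagrangian subspaces of the symbol *)

Section SymbolAlgebra.
Context {R : realType} {W T : vectType R} (p : 'Hom(W, T)) (k r : nat).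
Hypotheses (hr : (r.+1 <= k.+1)%N) (p_onto : limg p = fullv).
Let V := lker p.
Implicit Types (f : altform k.+1 W R^o) (L : {vspace W}).

Lemma p_invK t : p ((p^-1)%VF t) = t.
Proof. by rewrite limg_lfunVK // p_onto memvf. Qed.

(** The arguments of the symbol after its first one, so that contracting the symbol amounts to
    contracting [f]. The length [k.+1 - r.+1] is kept as in the type of [symbol]. *)
Definition splitting_tuple (v : r.-tuple (subvs_of V)) (t : (k.+1 - r.+1).-tuple T) :
    k.-tuple W :=
  [tuple nth 0 (map vsval v ++ map (p^-1)%VF t) i | i < k].

Lemma symbol_args_cons (l : subvs_of V) (v : r.-tuple (subvs_of V)) t :
  @symbol_args R W T p k r.+1 [tuple of l :: v] t = [tuple of vsval l :: splitting_tuple v t].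
Proof.
apply: eq_from_tnth => i; rewrite tnth_mktuple (tnth_nth 0) /=.
case: (unliftP ord0 i) => [j ->|->] //=.
transitivity (tnth (splitting_tuple v t) j); first by rewrite tnth_mktuple.
by rewrite (tnth_nth 0).
Qed.

Lemma splitting_tuple_eq : k = (r + (k.+1 - r.+1))%N.
Proof. by rewrite subSS subnKC. Qed.
Let e := splitting_tuple_eq.

Lemma splitting_tuplel v t i :
  tnth (splitting_tuple v t) (cast_ord (esym e) (lshift _ i)) = vsval (tnth v i).
Proof.
rewrite tnth_mktuple nth_cat size_map size_tuple /= ltn_ord.
by rewrite (nth_map 0) ?size_tuple // (tnth_nth 0).
Qed.

Lemma splitting_tupler v t j :
  tnth (splitting_tuple v t) (cast_ord (esym e) (rshift _ j)) = (p^-1)%VF (tnth t j).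
Proof.
rewrite tnth_mktuple nth_cat size_map size_tuple /= ltnNge leq_addr /= addKn.
by rewrite (nth_map 0) ?size_tuple // (tnth_nth 0).
Qed.

Lemma symbol_cons f (l : subvs_of V) v t :
  contr l (symbol p hr f) v t = contr (vsval l) f (splitting_tuple v t).
Proof. by rewrite !contrE -symbol_args_cons. Qed.

(** The projection of [W] onto [V] along the image of the splitting. *)
Definition vert_part : 'Hom(W, W) := \1%VF - (p^-1 \o p)%VF.

Lemma lift_decomposable L (a : 'I_r -> 'Hom(subvs_of V, R^o))
    (b : 'I_(k.+1 - r.+1) -> 'Hom(T, R^o)) (c : R) : (L <= V)%VS ->
  (forall i, (linfun vsval @^-1: L <= lker (a i))%VS) ->
  exists alpha : altform k W R^o, [/\ ext_annihilator L alpha, horizontal r V alpha &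
    forall v t, alpha (splitting_tuple v t) =
      \det (\matrix_(i, j) (a i (tnth v j) : R)) *
      (\det (\matrix_(i, j) (b i (tnth t j) : R)) * c)].
Proof.
move=> LV aL.
pose row (i : 'I_k) : 'Hom(W, R^o) := match fintype.split (cast_ord e i) with
  | inl i' => (a i' \o (linfun (vsproj V) \o vert_part))%VF
  | inr j => (b j \o p)%VF end.
have rowl i w : row (cast_ord (esym e) (lshift _ i)) w = a i (vsproj V (vert_part w)).
  by rewrite /row cast_ordKV (unsplitK (inl i)) /= !comp_lfunE lfunE.
have rowr i w : row (cast_ord (esym e) (rshift _ i)) w = b i (p w).
  by rewrite /row cast_ordKV (unsplitK (inr i)) /= comp_lfunE.
have pV w : w \in V -> p w = 0 by rewrite memv_ker => /eqP.
have vertV w : w \in V -> vert_part w = w.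
  by move=> /pV pw; rewrite add_lfunE opp_lfunE id_lfunE comp_lfunE pw linear0 subr0.
exists (detform row (c : R^o)); split.
- apply: ext_annihilator_detform => i; apply/subvP => w wL; rewrite memv_ker.
  have wV : w \in V by exact: (subvP LV).
  case: (fintype.splitP (cast_ord e i)) => j ij.
    have -> : i = cast_ord (esym e) (lshift _ j) by apply: val_inj.
    rewrite rowl vertV //; have /subvP/(_ (vsproj V w)) := aL j.
    by rewrite mem_lpreim_vsval vsprojK // memv_ker; apply.
  have -> : i = cast_ord (esym e) (rshift _ j) by apply: val_inj.
  by rewrite rowr pV ?linear0.
(* The [k - r] rows coming from [T] vanish on the [r.+1] vertical columns, and this zero block is
   too large for a non-zero determinant of size [k]. *)
- move=> rk u uV; rewrite detformE (det_zero_block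
    (I := [set cast_ord (esym e) (rshift r j) | j : 'I_(k.+1 - r.+1)]%SET)
    (J := [set widen_ord rk j | j : 'I_r.+1]%SET)) ?scale0r //.
    rewrite !card_imset ?card_ord; last 2 first.
    + by move=> i j /(congr1 val) /= /val_inj.
    + by move=> i j /cast_ord_inj/rshift_inj.
    by rewrite [X in (X < _)%N]e addnC addnS.
  move=> _ _ /imsetP[i _ ->] /imsetP[j _ ->]; rewrite mxE rowr pV ?linear0 //.
  by apply: uV; rewrite /= -ltnS.
(* On these arguments the matrix is block diagonal: the rows [b] kill vertical vectors, and the
   splitting inverts [p]. *)
- move=> v t; rewrite detformE mulrA; congr (_ * _).
  apply: (det_block_diag (e := e)) => i j; rewrite !mxE.
  + by rewrite splitting_tuplel rowl vertV ?subvsP // vsvalK.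
  + by rewrite splitting_tupler rowr p_invK.
  + by rewrite splitting_tuplel rowr pV ?subvsP // linear0.
Qed.

Lemma symbol_lift L (g : altform r (subvs_of V) (altform (k.+1 - r.+1) T R^o)) :
  (L <= V)%VS -> ext_annihilator (linfun vsval @^-1: L)%VS g ->
  exists alpha : altform k W R^o, [/\ ext_annihilator L alpha, horizontal r V alpha &
    forall v t, alpha (splitting_tuple v t) = g v t].
Proof.
move=> LV [q [a [h [aL gE]]]].
suff [alpha alphaP] : exists alpha : 'I_q -> altform k W R^o, forall c,
    [/\ ext_annihilator L (alpha c), horizontal r V (alpha c) & forall v t,
      alpha c (splitting_tuple v t) = \det (\matrix_(i, j) (a c i (tnth v j) : R)) * h c t].
  exists (\sum_c alpha c); split.
  - by apply: ext_annihilator_sum => c; case: (alphaP c).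
  - elim/big_ind: _ => // [x y|c _]; [exact: horizontalD|by case: (alphaP c)].
  - move=> v t; rewrite gE !altform_sumE; apply: eq_bigr => c _.
    by have [_ _ ->] := alphaP c.
suff alphaP c : exists alpha : altform k W R^o,
    [/\ ext_annihilator L alpha, horizontal r V alpha & forall v t,
      alpha (splitting_tuple v t) = \det (\matrix_(i, j) (a c i (tnth v j) : R)) * h c t].
  by exists (fun c => projT1 (cid (alphaP c))) => c; exact: projT2 (cid (alphaP c)).
(* The coefficient [h c] is itself a sum of determinants, since every form vanishes as soon as an
   argument is 0. *)
have /ext_annihilatorP [q' [b [y [_ hE]]]] : vanishes 0%VS (h c).
  by move=> t i; rewrite memv0 => /eqP t0; rewrite -(tsubst_id t i) t0 altform_tsubst0.
suff [beta betaP] : exists beta : 'I_q' -> altform k W R^o, forall d,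
    [/\ ext_annihilator L (beta d), horizontal r V (beta d) & forall v t,
      beta d (splitting_tuple v t) = \det (\matrix_(i, j) (a c i (tnth v j) : R)) *
        (\det (\matrix_(i, j) (b d i (tnth t j) : R)) * y d)].
  exists (\sum_d beta d); split.
  - by apply: ext_annihilator_sum => d; case: (betaP d).
  - elim/big_ind: _ => // [x z|d _]; [exact: horizontalD|by case: (betaP d)].
  - move=> v t; rewrite hE altform_sumE mulr_sumr; apply: eq_bigr => d _.
    by have [_ _ ->] := betaP d.
have betaP d := lift_decomposable (b d) (y d) LV (aL c).
by exists (fun d => projT1 (cid (betaP d))) => d; exact: projT2 (cid (betaP d)).
Qed.

Lemma symbol_polylagrangian N f L :
  multilagrangian_subspace r.+1 N V f L ->
  polylagrangian_subspace N (symbol p hr f) (linfun vsval @^-1: L)%VS.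
Proof.
move=> [LV dV fL]; split; first by rewrite dim_subvs dim_lpreim_vsval.
apply/seteqP; split=> [_ [l lL <-]|g gL].
  apply/ext_annihilatorP => v i vi; apply: altformP => t; rewrite symbol_cons altform0E.
  have : (ext_annihilator L `&` [set g | horizontal r V g]) (contr (vsval l) f).
    by rewrite -fL; exists (vsval l) => //; rewrite /= -mem_lpreim_vsval.
  move=> [/ext_annihilatorP lf _]; apply: (lf _ (cast_ord (esym e) (lshift _ i))).
  by rewrite splitting_tuplel -mem_lpreim_vsval.
have [alpha [alphaL alphaV alphaE]] := symbol_lift LV gL.
have : (ext_annihilator L `&` [set g | horizontal r V g]) alpha by split.
rewrite -fL => -[l lL lf]; have lV : l \in V by exact: (subvP LV).
exists (vsproj V l); first by rewrite /= mem_lpreim_vsval vsprojK.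
apply: altformP => v; apply: altformP => t.
by rewrite symbol_cons vsprojK // lf alphaE.
Qed.

(** If the codimension of [L] were below [k], all contractions of [f] with [L] would vanish. Then
    [f] would vanish on [L], and its degree is larger still, so it would be zero. *)
Lemma multilagrangian_degree N f L : f != 0 -> multilagrangian_subspace r.+1 N V f L ->
  (\dim L + k <= \dim {:W})%N.
Proof.
move=> f0 [LV dV fL]; rewrite leqNgt; apply: contra f0 => Lk; apply/eqP.
apply: (vanishes_eq0 (L := L)); last by rewrite addnS ltnS ltnW.
apply/vanishesP => l lL; apply: (vanishes_eq0 _ Lk); apply/ext_annihilatorP.
have : (ext_annihilator L `&` [set g | horizontal r V g]) (contr l f).
  by rewrite -fL; exists l.
by case.
Qed.

Lemma dim_vert : \dim {:W} = (\dim V + \dim {:T})%N.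
Proof. by rewrite -(limg_ker_dim p fullv) capfv p_onto. Qed.

End SymbolAlgebra.

(** * The kernel of a form and the kernel of its symbol *)

Section SymbolKernel.
Context {R : realType} {W T : vectType R} (p : 'Hom(W, T)).
Hypothesis p_onto : limg p = fullv.
Let V := lker p.

Lemma formker_vert k r N (f : altform k.+2 W R^o) L :
  (k.+1 - r <= \dim {:T})%N -> f != 0 -> multilagrangian_subspace r.+1 N V f L ->
  (formker f <= V)%VS.
Proof.
move=> rk f0 fL; have Lk := multilagrangian_degree f0 fL.
have [LV dV fLE] := fL; apply/subvP => w /mem_formker wf.
have {}wf : contr w f = 0 by exact: wf.
apply: contraT => wV; set n := \dim {:T} in rk.
have dW := dim_vert p_onto; rewrite -/n in dW.
(* The first covectors kill all of [V], which makes the form horizontal; the others kill only [L],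
   because at most [n] independent covectors kill [V]. *)
pose K (i : 'I_k.+1) := if (i < n)%N then V else L.
(* A non-vertical [w] forces [T] to be non-zero, so that the first subspace is [V], which avoids
   [w]. *)
have n0 : (0 < n)%N.
  rewrite lt0n; apply: contra wV => /eqP n0; rewrite (_ : V = fullv) ?memvf //.
  by apply/eqP; rewrite eqEdim subvf dW n0 addn0 /=.
have [| |a [u [aK au]]] := dual_vectors (K := K) (v := w).
- by rewrite /K n0.
- move=> i; rewrite /K; case: ifP => [i_n|_]; first by rewrite dW ltn_add2l.
  by apply: leq_trans Lk; rewrite ltn_add2l ltn_ord.
have alphaL : ext_annihilator L (detform a (1 : R^o)).
  apply: ext_annihilator_detform => i; apply: subv_trans (aK i).
  by rewrite /K; case: ifP.
have alphaV : horizontal r V (detform a (1 : R^o)).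
  move=> rk' x xV; have mk : (minn n k.+1 <= k.+1)%N by exact: geq_minr.
  (* The zero block has [minn n k.+1] rows and [r.+1] columns, which exceeds the size [k.+1] because
     [k.+1 - r <= n]. *)
  rewrite detformE (det_zero_block (I := [set widen_ord mk j | j : 'I_(minn n k.+1)]%SET)
    (J := [set widen_ord rk' j | j : 'I_r.+1]%SET)) ?scale0r //.
    rewrite !card_imset ?card_ord; last 2 first.
    + by move=> i j /(congr1 val) /= /val_inj.
    + by move=> i j /(congr1 val) /= /val_inj.
    rewrite /minn; case: (ltnP n k.+1) => nk; last by rewrite addnS ltnS leq_addr.
    by rewrite addnS ltnS addnC -leq_subLR.
  move=> _ _ /imsetP[i _ ->] /imsetP[j _ ->]; rewrite mxE; apply/eqP.
  rewrite -memv_ker; apply: (subvP (aK _)); rewrite /K /= (leq_trans (ltn_ord i)) ?geq_minl //.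
  by apply: xV; rewrite /= -ltnS.
have : (ext_annihilator L `&` [set g | horizontal r V g]) (detform a (1 : R^o)) by split.
rewrite -fLE => -[l _ fl].
have : contr w (detform a (1 : R^o)) u = 0 by rewrite -fl contr_contr_eq0.
by rewrite contrE detformE au scale1r => /eqP; rewrite oner_eq0.
Qed.

(** Any lifts of the vectors of [T] may replace those given by the splitting: they differ by
    vertical vectors, and [r] vertical arguments are already present. *)
Lemma symbol_eq k r (hr : (r <= k.+1)%N) (f : altform k.+1 W R^o) v t (y : k.+1.-tuple W) :
  horizontal r V f ->
  (forall i, tnth y (widen_ord hr i) = vsval (tnth v i)) ->
  (forall j, p (tnth y (Ordinal (symbol_pos_subproof j))) = tnth t j) ->
  symbol p hr f v t = f y.
Proof.
move=> fV yv yt; apply: (horizontal_congr fV) => i.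
  move=> ir; have -> : i = widen_ord hr (Ordinal ir) by apply: val_inj.
  by rewrite yv symbol_argsl subvsP.
have [[j ->]|[j ->]] := symbol_posP hr i; first by rewrite yv symbol_argsl subrr rpred0.
by rewrite symbol_argsr memv_ker linearB /= yt p_invK // subrr.
Qed.

Lemma formker_symbol k r (hr : (r.+1 <= k.+1)%N) (f : altform k.+1 W R^o) :
  (formker f <= V)%VS -> (formker f <= linfun vsval @: formker (symbol p hr f))%VS.
Proof.
move=> fV; apply/subvP => w wf; have wV := subvP fV _ wf.
move: wf => /mem_formker wf; have {}wf : contr w f = 0 by exact: wf.
apply/memv_imgP; exists (vsproj V w); last by rewrite linfun_vsval vsprojK.
apply/mem_formker => //; apply: altformP => v; apply: altformP => t.
by rewrite symbol_cons vsprojK // wf.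
Qed.

Lemma dim_formker_symbol k (hr : (2 <= k.+2)%N) (f : altform k.+2 W R^o) :
  \dim {:T} = k.+1 -> horizontal 2 V f ->
  (\dim (formker (symbol p hr f)) <= \dim (formker f) + 1)%N.
Proof.
move=> dT fV; rewrite -dim_img_vsval; set K := (_ @: _)%VS.
have dW : (\dim V + k.+1 = \dim {:W})%N by rewrite (dim_vert p_onto) dT.
have [u0 u0P] := vanishes_top_form dW.
have KV w : w \in K -> vanishes V (contr w f).
  move=> /memv_imgP[x /mem_formker xf ->]; rewrite linfun_vsval.
  have {}xf : contr x (symbol p hr f) = 0 by exact: xf.
  have ek : (k.+2 - 2 = k)%N by rewrite subn2.
  apply/vanishesP => v vV; apply: altformP => u; rewrite !contrE altform0E.
  (* The zero becomes a value of the contracted symbol, whose arguments from [T] are lifted by the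
     entries of [u] themselves. *)
  have <- : contr x (symbol p hr f) [tuple vsproj V v]
      [tuple p (tnth u (cast_ord ek i)) | i < k.+2 - 2] = 0 by rewrite xf.
  apply: esym; rewrite contrE; apply: symbol_eq => // [i|j].
    rewrite !(tnth_nth 0); case: i => [[|[|//]] ?] //=.
    by rewrite vsprojK.
  rewrite tnth_mktuple; congr (p _).
  by rewrite !(tnth_nth 0).
(* Evaluation at [u0] is one linear condition, and on [K] it cuts out vectors of the kernel of [f];
   hence the defect of at most 1. *)
pose c0 w : R^o := contr w f u0.
have c0_lin : linear c0 by move=> a x y; rewrite /c0 contr_linear.
pose c0M := GRing.isLinear.Build _ _ _ _ c0 c0_lin.
pose c : 'Hom(W, R^o) := linfun (HB.pack c0 c0M : {linear W -> R^o}).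
rewrite -(limg_ker_dim c K); apply: leq_add; last first.
  by rewrite (leq_trans (dimvS (subvf _))) // dimvf.
apply/dimvS/subvP => w; rewrite memv_cap memv_ker lfunE => /andP[wK /eqP cw].
by apply/mem_formker => //; apply: u0P => //; exact: KV.
Qed.

End SymbolKernel.

Section SymbolRank.
Context {R : realType}.

Lemma altform_nonzero (T : vectType R) s : (s <= \dim {:T})%N ->
  exists e : altform s T R^o, e != 0.
Proof.
move=> sT; have [|e _ e0] := @vanishes_nonzero R s T R^o 0%VS 1 (oner_neq0 _).
  by rewrite dimv0.
by exists e.
Qed.

(** [formker_rank_le] is applied in both directions to auxiliary subspaces of equal dimension. *)
Lemma dim_formker_polylagrangian r N (V V' : vectType R) (E : lmodType R)
    (f : altform r.+1 V E) (f' : altform r.+1 V' E) L L' (e : E) :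
  \dim {:V} = \dim {:V'} -> e != 0 -> (r <= N)%N ->
  polylagrangian_subspace N f L -> polylagrangian_subspace N f' L' ->
  \dim (formker f) = \dim (formker f').
Proof.
move=> dVV' e0 rN fL f'L'.
(* For r > 0 the kernel lies in every polylagrangian subspace, but for r = 0 it need not,
   and then the whole space can be used instead, as every 0-form is in the image. *)
suff [K [K' [dK kK kK' fK fK']]] : exists (K : {vspace V}) (K' : {vspace V'}),
    [/\ \dim K = \dim K', (formker f <= K)%VS, (formker f' <= K')%VS,
      [set contr x f | x in [set` K]] = ext_annihilator L &
      [set contr x f' | x in [set` K']] = ext_annihilator L'].
  apply/eqP; rewrite eqn_leq -(leq_add2l (\dim K)) -[X in _ && X](leq_add2l (\dim K)).
  rewrite {1 4}dK (formker_rank_le f'L'.1 fL.1 kK' kK fK' fK).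
  by rewrite (formker_rank_le fL.1 f'L'.1 kK kK' fK fK').
case: r f f' fL f'L' rN => [|r] f f' fL f'L' rN; last first.
  exists L, L'; split; [|exact: formker_polylagrangian fL e0 rN
    |exact: formker_polylagrangian f'L' e0 rN|exact: fL.2|exact: f'L'.2].
  by apply/eqP; rewrite -(eqn_add2r N) -fL.1 -f'L'.1 dVV'.
have full (U : vectType R) (K : {vspace U}) (g : altform 1 U E) :
    polylagrangian_subspace N g K ->
    [set contr l g | l in [set` fullv]] = ext_annihilator K.
  move=> [_ gK]; apply/seteqP; split=> [_ [x _ <-]|h].
    by apply/ext_annihilatorP => u [].
  by rewrite -gK => -[x _ <-]; exists x; rewrite /= ?memvf.
by exists fullv, fullv; rewrite !subvf (full _ _ _ fL) (full _ _ _ f'L').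
Qed.

End SymbolRank.

(** * Charts of a fiber bundle *)

Section Calculus.
Context {R : realType}.
Implicit Types (X Y Z : normedModType R).

(** The first-order expansion of [f] at [x] is also one of [g], and the linear part of such an
    expansion is unique. *)
Lemma near_eq_diff X Y (f g : X -> Y) x :
  (\near x, f x = g x) -> differentiable f x ->
  differentiable g x /\ 'd g x = 'd f x :> (X -> Y).
Proof.
move=> fg df; have [dfc dfE] := (diff_locallyP _ _).1 df.
have gE : g \o shift x = cst (g x) + 'd f x +o_ 0 id.
  apply/eqaddoP => e e0; have /eqaddoP /(_ e e0) := dfE.
  have fgh : \forall h \near (0 : X), f (h + x) = g (h + x).
    by move: fg; rewrite (near_shift 0 x) /= subr0.
  apply: filterS2 fgh => h fgh; rewrite !fctE /= -(nbhs_singleton fg).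
  by rewrite fgh.
split; first by apply/diff_locallyP; rewrite (diff_unique dfc gE).
exact: diff_unique.
Qed.

Lemma diff_compE X Y Z (f : X -> Y) (g : Y -> Z) x v :
  differentiable f x -> differentiable g (f x) ->
  'd (g \o f) x v = 'd g (f x) ('d f x v).
Proof. by move=> df dg; rewrite diff_comp. Qed.

Lemma near_open (T : topologicalType) (U : set T) (Q : T -> Prop) x :
  open U -> U x -> (forall y, U y -> Q y) -> \near x, Q x.
Proof. by move=> Uo Ux UQ; apply: (filterS UQ); exact: open_nbhs_nbhs. Qed.

Lemma Ck_sub k X Y (U V : set X) (f : X -> Y) : U `<=` V -> Ck k V f -> Ck k U f.
Proof.
elim: k f => [|k IH] f UV /=; first by move=> fV x /UV; exact: fV.
by move=> [df dDf]; split=> [x /UV /df //|v]; exact: IH.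
Qed.

Lemma Ck_eq k X Y (U : set X) (f g : X -> Y) :
  open U -> {in U, f =1 g} -> Ck k U f -> Ck k U g.
Proof.
move=> Uo; elim: k f g => [|k IH] f g fg /=.
  move=> fc x Ux; have fgx : \near x, f x = g x.
    by apply: (near_open Uo Ux) => y Uy; apply: fg; rewrite inE.
  rewrite /prop_for /continuous_at -(nbhs_singleton fgx).
  exact: cvg_trans (near_eq_cvg fgx) (fc x Ux).
move=> [df dDf]; split=> [x Ux|v].
  have fgx : \near x, f x = g x.
    by apply: (near_open Uo Ux) => y Uy; apply: fg; rewrite inE.
  exact: (near_eq_diff fgx (df x Ux)).1.
apply: IH (dDf v) => x; rewrite inE => Ux; apply: near_eq_derive.
by apply: (near_open Uo Ux) => y Uy; apply: fg; rewrite inE.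
Qed.

Lemma smooth_on_eq X Y (U V : set X) (f g : X -> Y) :
  open U -> U `<=` V -> {in U, f =1 g} -> smooth_on V f -> smooth_on U g.
Proof. by move=> Uo UV fg sf k; exact: Ck_eq Uo fg (Ck_sub UV (sf k)). Qed.

Lemma smooth_on_differentiable X Y (U : set X) (f : X -> Y) x :
  smooth_on U f -> U x -> differentiable f x.
Proof. by move=> /(_ 1%N) [df _] /df. Qed.

Lemma continuous_row_mx (T : topologicalType) a b (f : T -> 'rV[R]_a) (g : T -> 'rV[R]_b) x :
  {for x, continuous f} -> {for x, continuous g} ->
  {for x, continuous (fun y => row_mx (f y) (g y))}.
Proof.
move=> fc gc A /nbhs_ballP[e /= e0 eA]; rewrite nbhs_filterE.
have /fc fe : nbhs (f x) (ball (f x) e) by exact: nbhsx_ballx.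
have /gc ge : nbhs (g x) (ball (g x) e) by exact: nbhsx_ballx.
rewrite /nbhs /=; near=> y; apply: eA.
have [_ fy] : ball (f x) e (f y) by near: y.
have [_ gy] : ball (g x) e (g y) by near: y.
split=> // i j; rewrite !mxE; case: fintype.split => l; [exact: fy|exact: gy].
Unshelve. all: by end_near. Qed.

Lemma row_mx0l_linear a b : linear (fun x : 'rV[R]_a => row_mx x (0 : 'rV[R]_b)).
Proof. by move=> c x y; rewrite scale_row_mx add_row_mx scaler0 addr0. Qed.

Lemma row_mx0r_linear a b : linear (fun y : 'rV[R]_b => row_mx (0 : 'rV[R]_a) y).
Proof. by move=> c x y; rewrite scale_row_mx add_row_mx scaler0 addr0. Qed.

Lemma is_diff_row_mx0l a b (x : 'rV[R]_a) :
  is_diff x (fun x => row_mx x (0 : 'rV[R]_b)) (fun x => row_mx x 0).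
Proof.
pose M := GRing.isLinear.Build _ _ _ _ _ (@row_mx0l_linear a b).
pose l : {linear 'rV[R]_a -> 'rV[R]_(a + b)} := HB.pack (fun x => row_mx x 0) M.
have lc : continuous l.
  by move=> y; apply: (@continuous_row_mx _ _ _ id (cst 0)); [by move=> A|exact: cst_continuous].
by apply: DiffDef; [exact: (linear_differentiable x lc)|exact: (diff_lin x lc)].
Qed.

Lemma is_diff_row_mx0r a b (y : 'rV[R]_b) :
  is_diff y (fun y => row_mx (0 : 'rV[R]_a) y) (fun y => row_mx 0 y).
Proof.
pose M := GRing.isLinear.Build _ _ _ _ _ (@row_mx0r_linear a b).
pose l : {linear 'rV[R]_b -> 'rV[R]_(a + b)} := HB.pack (fun y => row_mx 0 y) M.
have lc : continuous l.
  by move=> x; apply: (@continuous_row_mx _ _ _ (cst 0) id); [exact: cst_continuous|by move=> A].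
by apply: DiffDef; [exact: (linear_differentiable y lc)|exact: (diff_lin y lc)].
Qed.

Lemma is_diff_row_mx X a b (f df : X -> 'rV[R]_a) (g dg : X -> 'rV[R]_b) x :
  is_diff x f df -> is_diff x g dg ->
  is_diff x (fun y => row_mx (f y) (g y)) (fun y => row_mx (df y) (dg y)).
Proof.
move=> fx gx; have dl := is_diff_row_mx0l b (f x); have dr := is_diff_row_mx0r a (g x).
have -> : (fun y => row_mx (f y) (g y)) =
    ((fun x => row_mx x (0 : 'rV[R]_b)) \o f) + ((fun y => row_mx (0 : 'rV[R]_a) y) \o g).
  by apply: funext => y; rewrite !fctE /= add_row_mx addr0 add0r.
have -> : (fun y => row_mx (df y) (dg y)) =
    ((fun x => row_mx x (0 : 'rV[R]_b)) \o df) + ((fun y => row_mx (0 : 'rV[R]_a) y) \o dg).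
  by apply: funext => y; rewrite !fctE /= add_row_mx addr0 add0r.
exact: is_diffD.
Qed.

Lemma is_diff_row_mxr a b (x : 'rV[R]_a) (y : 'rV[R]_b) :
  is_diff y (fun y => row_mx x y) (fun y => row_mx 0 y).
Proof. by apply: (@is_diff_row_mx _ _ _ (cst x) 0 id id). Qed.

Lemma is_diff_lsubmx a b (z : 'rV[R]_(a + b)) : is_diff z lsubmx lsubmx.
Proof.
apply: DiffDef; first exact: differentiable_lsubmx.
exact/diff_lin/continuous_lsubmx.
Qed.

Lemma Ck_row_mx k X a b (U : set X) (f : X -> 'rV[R]_a) (g : X -> 'rV[R]_b) :
  open U -> Ck k U f -> Ck k U g -> Ck k U (fun x => row_mx (f x) (g x)).
Proof.
move=> Uo; elim: k f g => [|k IH] f g /=.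
  by move=> fc gc x Ux; apply: continuous_row_mx; [exact: fc|exact: gc].
move=> [df Df] [dg Dg].
have dfg x : U x -> is_diff x (fun y => row_mx (f y) (g y))
    (fun y => row_mx ('d f x y) ('d g x y)).
  by move=> Ux; apply: is_diff_row_mx; apply: differentiableP; [exact: df|exact: dg].
split=> [x /dfg //|v].
apply: Ck_eq (IH _ _ (Df v) (Dg v)) => // x; rewrite inE => Ux.
have dx := dfg x Ux; rewrite !deriveE //; [|exact: dg|exact: df].
by rewrite diff_val.
Qed.

Lemma smooth_on_row_mx X a b (U : set X) (f : X -> 'rV[R]_a) (g : X -> 'rV[R]_b) :
  open U -> smooth_on U f -> smooth_on U g -> smooth_on U (fun x => row_mx (f x) (g x)).
Proof. by move=> Uo sf sg k; exact: Ck_row_mx. Qed.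

Lemma derive_row_mxr a b Y (g : 'rV[R]_(a + b) -> Y) (x : 'rV[R]_a) (y v : 'rV[R]_b) :
  'D_v (fun y => g (row_mx x y)) y = 'D_(row_mx 0 v) g (row_mx x y).
Proof.
rewrite /derive (_ : (fun h => h^-1 *: (((fun y => g (row_mx x y)) \o shift y) (h *: v) -
    g (row_mx x y))) = (fun h => h^-1 *: ((g \o shift (row_mx x y)) (h *: row_mx 0 v) -
    g (row_mx x y)))) //; apply: funext => h /=.
by rewrite scale_row_mx add_row_mx scaler0 add0r.
Qed.

End Calculus.

(** * Differentials read in charts *)

Section ChartDifferentials.
Context {R : realType}.

Lemma cimg_cinv d (M : topologicalType) (c : @chart R d M) x :
  cimg c x -> cdom c (cinv c x) /\ c (cinv c x) = x.
Proof. by move=> [p cp <-]; rewrite cinvK. Qed.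

Lemma cdom_cimg d (M : topologicalType) (c : @chart R d M) p : cdom c p -> cimg c (c p).
Proof. by exists p. Qed.

Lemma chart_at_cimg d (M : manifold R d) (p : M) : cimg (chart_at p) (chart_at p p).
Proof. exact/cdom_cimg/chart_at_dom. Qed.

Lemma nbhs_cinv d (M : topologicalType) (c : @chart R d M) x (A : set M) :
  cimg c x -> nbhs (cinv c x) A -> \near x, A (cinv c x).
Proof. by move=> cx; exact: cinv_cont. Qed.

Lemma chart_img_open d (N : topologicalType) (b : @chart R d N) (U : set N) :
  open U -> open (b @` (cdom b `&` U)).
Proof.
move=> Uo; rewrite openE => x [m [bm Um] <-]; have bx := cdom_cimg bm.
have : nbhs (cinv b (b m)) U by rewrite cinvK //; apply: open_nbhs_nbhs.
move=> /(nbhs_cinv bx) nearU.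
have near_im : nbhs (b m) (cimg b) by apply: open_nbhs_nbhs; split=> //; exact: cimg_open.
apply: filterS2 nearU near_im => y Uy cy; have [dy yy] := cimg_cinv cy.
by exists (cinv b y).
Qed.

Lemma transition_differentiable d (M : manifold R d) (c c' : @chart R d M) x :
  atlas c -> atlas c' -> cimg c x -> cdom c' (cinv c x) ->
  differentiable (c' \o cinv c) x.
Proof.
move=> ac ac' cx c'x; have [s _] := atlas_compatible ac ac'.
apply: (smooth_on_differentiable s); have [cc xx] := cimg_cinv cx.
by exists (cinv c x).
Qed.

(** Tangent vectors at [p] are written in the chart [chart_at p], so here [dcinv] differentiates a
    map that is the identity near the point. *)
Lemma dcinv_chart_at d (M : manifold R d) (p : M) v :
  dcinv (chart_at p) (chart_at p p) v = v.
Proof.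
rewrite /dcinv cinvK; last exact: chart_at_dom.
have idE : \forall x \near chart_at p p, idfun x = (chart_at p \o cinv (chart_at p)) x.
  apply: (@near_open _ (cimg (chart_at p))); [exact: cimg_open|exact: chart_at_cimg|].
  by move=> x cx /=; have [_ ->] := cimg_cinv cx.
have did : is_diff (chart_at p p) (idfun : 'rV[R]_d -> 'rV[R]_d) idfun by exact: is_diff_id.
have [_ ->] := near_eq_diff idE (@ex_diff _ _ _ _ _ _ _ did).
by rewrite (@diff_val _ _ _ _ _ _ _ did).
Qed.

Lemma tmapE d e (M : manifold R d) (N : manifold R e) (g : M -> N) p v :
  tmap g p v = 'd (chart_at (g p) \o g \o cinv (chart_at p)) (chart_at p p) v.
Proof. by rewrite lfunE. Qed.

(** The chain rule, with [tmap] defined through the selected chart and [c] arbitrary. The inverse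
    charts cancel only near [x], hence [near_eq_diff]. *)
Lemma tmap_dcinv d e (M : manifold R d) (N : manifold R e) (g : M -> N) (c : @chart R d M) x v :
  atlas c -> cimg c x ->
  differentiable (chart_at (g (cinv c x)) \o g \o cinv (chart_at (cinv c x)))
    (chart_at (cinv c x) (cinv c x)) ->
  differentiable (chart_at (g (cinv c x)) \o g \o cinv c) x /\
  tmap g (cinv c x) (dcinv c x v) = 'd (chart_at (g (cinv c x)) \o g \o cinv c) x v.
Proof.
move=> ac cx; set p := cinv c x; set b := chart_at (g p); set cp := chart_at p => dg.
have dcp : differentiable (cp \o cinv c) x.
  by apply: transition_differentiable => //; [exact: chart_at_atlas|exact: chart_at_dom].
have dcomp : differentiable ((b \o g \o cinv cp) \o (cp \o cinv c)) x.
  exact: differentiable_comp.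
have E : \near x, ((b \o g \o cinv cp) \o (cp \o cinv c)) x = (b \o g \o cinv c) x.
  have : nbhs (cinv c x) (cdom cp).
    by apply: open_nbhs_nbhs; split; [exact: cdom_open|exact: chart_at_dom].
  move=> /(nbhs_cinv cx); apply: filterS => y cpy /=.
  by rewrite cinvK.
have [dbg dE] := near_eq_diff E dcomp; split; first exact: dbg.
rewrite dE tmapE /dcinv -/p -/cp -/b.
exact: esym (diff_compE v dcp dg).
Qed.

End ChartDifferentials.

(** * The chart of the total space given by a trivialization and two charts *)

Section ProductChart.
Context {R : realType} {n f : nat} {M : manifold R n} {F : manifold R f}
  {P : manifold R (n + f)} {proj : P -> M}.
Hypothesis proj_smooth : smooth_map setT proj.
Variable (t : @local_trivialization R n f M F P proj).
Variables (c : @chart R n M) (c' : @chart R f F).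

Let dom : set P := [set p | [/\ tr_base t (proj p), cdom c (proj p) & cdom c' (tr_fib t p)]].
Let map (p : P) : 'rV[R]_(n + f) := row_mx (c (proj p)) (c' (tr_fib t p)).
Let inv (z : 'rV[R]_(n + f)) : P := tr_inv t (cinv c (lsubmx z)) (cinv c' (rsubmx z)).

Definition prod_cimg : set 'rV[R]_(n + f) :=
  [set z | (c @` (cdom c `&` tr_base t)) (lsubmx z) /\ cimg c' (rsubmx z)].

Lemma prod_cinv z : prod_cimg z ->
  [/\ dom (inv z), map (inv z) = z, proj (inv z) = cinv c (lsubmx z) &
      tr_fib t (inv z) = cinv c' (rsubmx z)].
Proof.
move=> [[m [cm tm] mz] [y cy yz]]; have [pr fi] := tr_invK y tm.
have [zm zy] : cinv c (lsubmx z) = m /\ cinv c' (rsubmx z) = y.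
  by rewrite -mz -yz !cinvK.
rewrite /dom /map /inv zm zy /= pr fi; split=> //.
by rewrite mz yz hsubmxK.
Qed.

Lemma prod_map p : dom p -> prod_cimg (map p) /\ inv (map p) = p.
Proof.
move=> [tp cp c'p]; split.
  by split; rewrite ?row_mxKl ?row_mxKr; [exists (proj p)|exists (tr_fib t p)].
by rewrite /inv /map row_mxKl row_mxKr !cinvK // tr_fibK.
Qed.

Lemma prod_cimgE : map @` dom = prod_cimg.
Proof.
apply/seteqP; split=> [_ [p /prod_map[] + _ <-]//|z /prod_cinv[dz mz _ _]].
by exists (inv z).
Qed.

Lemma proj_continuous (p : P) : {for p, continuous proj}.
Proof. exact: proj_smooth.1. Qed.

Lemma prod_dom_open : open dom.
Proof.
rewrite openE => p [tp cp c'p].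
have tpn : nbhs (proj p) (tr_base t) by apply: open_nbhs_nbhs; split=> //; exact: tr_base_open.
have cpn : nbhs (proj p) (cdom c) by apply: open_nbhs_nbhs; split=> //; exact: cdom_open.
have c'pn : nbhs (tr_fib t p) (cdom c') by apply: open_nbhs_nbhs; split=> //; exact: cdom_open.
have fc := (tr_fib_smooth t).1 p tp.
have t1 : \forall q \near p, tr_base t (proj q) := proj_continuous tpn.
have t2 : \forall q \near p, cdom c (proj q) := proj_continuous cpn.
have t3 : \forall q \near p, cdom c' (tr_fib t q) := fc _ c'pn.
have domP q : tr_base t (proj q) -> cdom c (proj q) -> cdom c' (tr_fib t q) -> dom q by split.
exact: (filterS3 _ domP t1 t2 t3).
Qed.

Lemma prod_cimg_open : open prod_cimg.
Proof.
have o1 := chart_img_open (b := c) (tr_base_open t).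
rewrite (_ : prod_cimg = (lsubmx @^-1` (c @` (cdom c `&` tr_base t))) `&` (rsubmx @^-1` cimg c')) //.
apply: openI; apply: open_comp => //.
- by move=> z _; exact: continuous_lsubmx.
- by move=> z _; exact: continuous_rsubmx.
- exact: cimg_open.
Qed.

Lemma prod_map_cont p : dom p -> {for p, continuous map}.
Proof.
move=> [tp cp c'p]; apply: continuous_row_mx.
  by apply: continuous_comp; [exact: proj_continuous|exact: cmap_cont].
apply: continuous_comp; [exact: (tr_fib_smooth t).1|exact: cmap_cont].
Qed.

Lemma prod_inv_cont z : (map @` dom) z -> {for z, continuous inv}.
Proof.
rewrite prod_cimgE => -[[m [cm tm] mz] zc'].
pose g (z : 'rV[R]_(n + f)) : M * F := (cinv c (lsubmx z), cinv c' (rsubmx z)).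
apply: (@continuous_comp _ _ _ g (fun q : M * F => tr_inv t q.1 q.2)).
  have g1 : {for z, continuous (cinv c \o (lsubmx : 'rV[R]_(n + f) -> 'rV[R]_n))}.
    apply: continuous_comp; first exact: continuous_lsubmx.
    by apply: cinv_cont; rewrite -mz; exists m.
  have g2 : {for z, continuous (cinv c' \o (rsubmx : 'rV[R]_(n + f) -> 'rV[R]_f))}.
    by apply: continuous_comp; [exact: continuous_rsubmx|exact: cinv_cont].
  exact: cvg_pair g1 g2.
by apply: (tr_inv_smooth t).1; rewrite /= -mz cinvK.
Qed.

Lemma prod_map_open : open (map @` dom).
Proof. rewrite prod_cimgE; exact: prod_cimg_open. Qed.

Definition prod_chart : @chart R (n + f) P :=
  @Chart R (n + f) P dom map inv prod_dom_open prod_map_open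
    (fun p hp => (prod_map hp).2) prod_map_cont prod_inv_cont.

Lemma cimg_prod_chart : cimg prod_chart = prod_cimg.
Proof. exact: prod_cimgE. Qed.

Lemma cinv_prod_chart z : cinv prod_chart z = tr_inv t (cinv c (lsubmx z)) (cinv c' (rsubmx z)).
Proof. by []. Qed.

Lemma proj_cinv_prod_chart z : prod_cimg z ->
  proj (cinv prod_chart z) = cinv c (lsubmx z).
Proof. by move=> /prod_cinv[]. Qed.

Hypotheses (ac : atlas c) (ac' : atlas c').

(** By maximality of the atlas, compatibility with its charts suffices. One transition map is
    [tr_inv] in coordinates; the other has the components [proj] and [tr_fib]. *)
Lemma prod_chart_atlas : atlas prod_chart.
Proof.
apply: atlas_maximal => b ab; split.
  have [_ /(_ c c' b ac ac' ab) s] := tr_inv_smooth t.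
  apply: smooth_on_eq s => //; first exact: (chart_img_open (cdom_open b)).
  move=> _ [p [[tp cp c'p] bp] <-]; exists (proj p), (tr_fib t p); split=> //.
  by rewrite tr_fibK.
have Uo := chart_img_open (b := b) prod_dom_open.
have [_ /(_ b c ab ac) s1] := proj_smooth.
have [_ /(_ b c' ab ac') s2] := tr_fib_smooth t.
have bo : open (b @` (cdom b `&` cdom prod_chart)) by exact: Uo.
have E : (b @` (cdom prod_chart `&` cdom b)) = (b @` (cdom b `&` cdom prod_chart)).
  by rewrite setIC.
rewrite E; apply: (smooth_on_row_mx bo).
  apply: smooth_on_eq s1 => // _ [p [bp [tp cp c'p]] <-].
  by exists p.
apply: smooth_on_eq s2 => // _ [p [bp [tp cp c'p]] <-].
by exists p.
Qed.

End ProductChart.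

Section ProductChartTangent.
Context {R : realType} {n f : nat} {M : manifold R n} {F : manifold R f}
  {P : manifold R (n + f)} {proj : P -> M}.
Hypothesis proj_smooth : smooth_map setT proj.
Variable (t : @local_trivialization R n f M F P proj).
Variables (c : @chart R n M) (c' : @chart R f F).
Hypotheses (ac : atlas c) (ac' : atlas c').
Let Phi := prod_chart proj_smooth t c c'.
Let aPhi : atlas Phi := prod_chart_atlas proj_smooth t ac ac'.

(** In product coordinates the inclusion of a fibre is [y] to [row_mx x y] with [x] fixed. *)
Lemma tmap_tr_inv z u : prod_cimg t c c' z ->
  tmap (tr_inv t (cinv c (lsubmx z))) (cinv c' (rsubmx z)) (dcinv c' (rsubmx z) u) =
  dcinv Phi z (row_mx 0 u).
Proof.
move=> zP; have [zc c'z] := zP; have [dz _ _ _] := prod_cinv zP.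
set x := lsubmx z; set y := rsubmx z; set m := cinv c x; set q := cinv c' y.
set p := tr_inv t m q.
have [cm tm] : cdom c m /\ tr_base t m.
  by rewrite /m /x; case: zc => m' [cm' tm'] <-; rewrite cinvK.
have cx : c m = x by rewrite /m /x; case: zc => m' [cm' tm'] <-; rewrite cinvK.
(* Smoothness is known jointly in both variables and is restricted to the slice over [m]. *)
have d1 : differentiable (chart_at p \o tr_inv t m \o cinv (chart_at q)) (chart_at q q).
  have [_ /(_ _ _ _ ac (chart_at_atlas q) (chart_at_atlas p)) s] := tr_inv_smooth t.
  have E : chart_at p \o tr_inv t m \o cinv (chart_at q) =
      (fun z => chart_at p (tr_inv t (cinv c (lsubmx z)) (cinv (chart_at q) (rsubmx z)))) \o
      (fun y => row_mx x y).
    by apply: funext => v /=; rewrite row_mxKl row_mxKr.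
  rewrite E; apply: differentiable_comp.
    exact: (@ex_diff _ _ _ _ _ _ _ (is_diff_row_mxr x _)).
  apply: (smooth_on_differentiable s); exists m, q; split=> //.
  - exact: chart_at_dom.
  - exact: chart_at_dom.
  - by rewrite cx.
have [d2 ->] := tmap_dcinv u ac' c'z d1.
have E : chart_at p \o tr_inv t m \o cinv c' = (chart_at p \o cinv Phi) \o (fun y => row_mx x y).
  by apply: funext => v /=; rewrite row_mxKl row_mxKr.
have zE : row_mx x y = z by rewrite hsubmxK.
have d3 : differentiable (chart_at p \o cinv Phi) (row_mx x y).
  rewrite zE; apply: transition_differentiable => //.
  - exact: chart_at_atlas.
  - by rewrite cimg_prod_chart.
  - exact: chart_at_dom.
have dr := is_diff_row_mxr x y.
rewrite -/m -/q -/p E (diff_compE u (@ex_diff _ _ _ _ _ _ _ dr) d3).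
by rewrite (@diff_val _ _ _ _ _ _ _ dr) zE.
Qed.

(** In product coordinates [proj] is [lsubmx], which is its own differential. *)
Lemma tmap_proj_dcinv z h : prod_cimg t c c' z ->
  tmap proj (cinv Phi z) (dcinv Phi z h) = dcinv c (lsubmx z) (lsubmx h).
Proof.
move=> zP; have [zc c'z] := zP.
have Phiz : cimg Phi z by rewrite cimg_prod_chart.
have pz : proj (cinv Phi z) = cinv c (lsubmx z) by exact: proj_cinv_prod_chart.
have [|_ ->] := tmap_dcinv (g := proj) h aPhi Phiz.
  have [_ /(_ _ _ (chart_at_atlas (cinv Phi z)) (chart_at_atlas (proj (cinv Phi z)))) s] :=
    proj_smooth.
  apply: (smooth_on_differentiable s); exists (cinv Phi z) => //.
  by split; [split=> //|]; exact: chart_at_dom.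
have cz : cimg c (lsubmx z) by case: zc => m [cm _] <-; exact: cdom_cimg.
pose b := chart_at (cinv c (lsubmx z)).
have d1 : differentiable (b \o cinv c) (lsubmx z).
  by apply: transition_differentiable => //; [exact: chart_at_atlas|exact: chart_at_dom].
have dl := is_diff_lsubmx z.
have d2 : differentiable ((b \o cinv c) \o lsubmx) z.
  by apply: differentiable_comp d1; exact: (@ex_diff _ _ _ _ _ _ _ dl).
have E : \forall z' \near z, ((b \o cinv c) \o lsubmx) z' = (b \o proj \o cinv Phi) z'.
  apply: (@near_open _ (prod_cimg t c c')) => //; first exact: prod_cimg_open.
  by move=> z' z'P /=; rewrite (proj_cinv_prod_chart proj_smooth).
rewrite pz; have [_ ->] := near_eq_diff E d2.
rewrite (diff_compE h (@ex_diff _ _ _ _ _ _ _ dl) d1).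
by rewrite (@diff_val _ _ _ _ _ _ _ dl).
Qed.

Lemma dcinv_vert z u : prod_cimg t c c' z ->
  dcinv Phi z (row_mx 0 u) \in vert proj (cinv Phi z).
Proof.
by move=> zP; rewrite memv_ker tmap_proj_dcinv // row_mxKl /dcinv linear0.
Qed.

End ProductChartTangent.

Section Submersion.
Context {R : realType} {n f : nat} {M : manifold R n} {F : manifold R f}
  {P : manifold R (n + f)} {proj : P -> M}.
Hypothesis hpi : fiber_bundle F proj.

(** In a product chart built on [chart_at (proj p)], the vector [row_mx v 0] projects to [v]. *)
Lemma tmap_proj_onto p : limg (tmap proj p) = fullv.
Proof.
have [ps /(_ (proj p)) [t tp]] := hpi.
set c := chart_at (proj p); set c' := chart_at (tr_fib t p).
have [zP pE] := prod_map (t := t) (c := c) (c' := c') (p := p)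
  (And3 tp (chart_at_dom _) (chart_at_dom _)).
apply/eqP; rewrite eqEsubv subvf /=; apply/subvP => v _.
have := tmap_proj_dcinv ps (chart_at_atlas _) (chart_at_atlas _) (row_mx v 0) zP.
rewrite cinv_prod_chart pE !row_mxKl dcinv_chart_at => <-.
by rewrite memv_img ?memvf.
Qed.

End Submersion.

(** * Smoothness and vertical closedness of the symbol *)

Section LocalSymbol.
Context {R : realType} {n f k r : nat} {M : manifold R n} {F : manifold R f}
  {P : manifold R (n + f)} {proj : P -> M}.
Hypotheses (hpi : fiber_bundle F proj) (hrk : (r <= k.+1)%N).
Variable w : P -> altform k.+1 'rV[R]_(n + f) R^o.
Hypothesis w_hor : forall p, horizontal r (vert proj p) (w p).

(** Vectors tangent to [F], then vectors tangent to [M], in product coordinates. The length [m] is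
    free, so that both [w] and its exterior derivative can be evaluated. *)
Definition split_args m r' s (u : r'.-tuple 'rV[R]_f) (a : s.-tuple 'rV[R]_n) :
    m.-tuple 'rV[R]_(n + f) :=
  [tuple nth 0 (map (fun y => row_mx 0 y) u ++ map (fun x => row_mx x 0) a) i | i < m].

Lemma split_argsl m r' s (u : r'.-tuple 'rV[R]_f) (a : s.-tuple 'rV[R]_n) (i : 'I_m) :
  (i < r')%N -> tnth (split_args m u a) i = row_mx 0 (nth 0 u i).
Proof.
move=> ir; rewrite tnth_mktuple nth_cat size_map size_tuple ir.
by rewrite (nth_map 0) ?size_tuple.
Qed.

Lemma split_argsr m r' s (u : r'.-tuple 'rV[R]_f) (a : s.-tuple 'rV[R]_n) (i : 'I_m) :
  (r' <= i)%N -> (i < r' + s)%N -> tnth (split_args m u a) i = row_mx (nth 0 a (i - r')) 0.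
Proof.
move=> ri irs; rewrite tnth_mktuple nth_cat size_map size_tuple ltnNge ri /=.
by rewrite (nth_map 0) // size_tuple ltn_subLR.
Qed.

(** The coordinate vectors along [M] are lifts of the prescribed tangent vectors of [M], so
    [symbol_eq] applies. *)
Lemma vsymbol_local_expr (t : @local_trivialization R n f M F P proj)
    (c : @chart R n M) (c' : @chart R f F) z (u : r.-tuple 'rV[R]_f)
    (a : (k.+1 - r).-tuple 'rV[R]_n) : atlas c -> atlas c' -> prod_cimg t c c' z ->
  local_expr c' (fiber_restr t (cinv c (lsubmx z)) (vsymbol proj hrk w)
    [tuple dcinv c (lsubmx z) (tnth a i) | i < k.+1 - r]) (rsubmx z) u =
  local_expr (prod_chart hpi.1 t c c') w z (split_args k.+1 u a).
Proof.
move=> ac ac' zP; rewrite /local_expr /fiber_restr /vsymbol.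
apply: (symbol_eq (tmap_proj_onto hpi _)).
- exact: w_hor.
- move=> i; rewrite tnth_mktuple split_argsl //= -tnth_nth !tnth_mktuple vsprojK.
    by rewrite (tmap_tr_inv hpi.1).
  by rewrite (tmap_tr_inv hpi.1) //; exact: dcinv_vert.
- move=> j; rewrite tnth_mktuple split_argsr /= ?leq_addr ?ltn_add2l //.
  rewrite (tmap_proj_dcinv hpi.1) // row_mxKl addKn.
  by rewrite -tnth_nth tnth_mktuple.
Qed.

Lemma smooth_vsymbol : smooth_form w -> smooth_vform F (vsymbol proj hrk w).
Proof.
move=> ws t c c' a u ac ac'.
have aPhi := prod_chart_atlas hpi.1 t ac ac'.
apply: smooth_on_eq (ws _ aPhi (split_args k.+1 u a)).
- exact: (prod_cimg_open (t := t) (c := c) (c' := c')).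
- by rewrite cimg_prod_chart.
- by move=> z; rewrite inE => zP; exact/esym/vsymbol_local_expr.
Qed.

Lemma vclosed_vsymbol : closed_form w -> vclosed F (vsymbol proj hrk w).
Proof.
move=> wc t m a tm c' ac' y u yc'.
(* In this chart the fixed arguments [a] are their own components. *)
set c := chart_at m; set Phi := prod_chart hpi.1 t c c'.
have ac : atlas c := chart_at_atlas m.
have aPhi : atlas Phi := prod_chart_atlas hpi.1 t ac ac'.
have cm : cinv c (c m) = m by rewrite cinvK //; exact: chart_at_dom.
have zP y' : cimg c' y' -> prod_cimg t c c' (row_mx (c m) y').
  move=> c'y'; split; rewrite ?row_mxKl ?row_mxKr //.
  by exists m => //; split=> //; exact: chart_at_dom.
have aE : a = [tuple dcinv c (c m) (tnth a i) | i < k.+1 - r].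
  by apply: eq_from_tnth => i; rewrite tnth_mktuple dcinv_chart_at.
have localE y' v : cimg c' y' ->
    local_expr c' (fiber_restr t m (vsymbol proj hrk w) a) y' v =
    local_expr Phi w (row_mx (c m) y') (split_args k.+1 v a).
  move=> /zP y'P; rewrite -(vsymbol_local_expr v a ac ac' y'P).
  by rewrite row_mxKl row_mxKr cm -aE.
have Phiz : cimg Phi (row_mx (c m) y) by rewrite cimg_prod_chart; exact: zP.
(* The closedness of [w] is tested on [r.+1] fibre vectors followed by base vectors; the sum splits
   according to the direction of differentiation. *)
have e : (r.+1 + (k.+1 - r) = k.+2)%N by rewrite addSn subnKC.
have := wc Phi aPhi (row_mx (c m) y) (split_args k.+2 u a) Phiz.
rewrite /ext_deriv (reindex (cast_ord e)) /=; last first.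
  by apply: onW_bij; exists (cast_ord (esym e)); [exact: cast_ordK|exact: cast_ordKV].
rewrite big_split_ord /= [X in _ + X]big1 ?addr0 => [closed0|j _].
  rewrite /ext_deriv -[RHS]closed0; apply: eq_bigr => i _; congr (_ * _); rewrite split_argsl /= ?ltn_ord // -tnth_nth.
  rewrite -(derive_row_mxr (fun z => local_expr Phi w z _)).
  apply: near_eq_derive; apply: (@near_open _ (cimg c')) => //; first exact: cimg_open.
  move=> y' c'y'; rewrite localE //; congr (local_expr Phi w _ _).
  apply: eq_from_tnth => l; rewrite [RHS]tnth_mktuple.
  have [lr|rl] := ltnP l r.
    rewrite split_argsl // split_argsl /=; last first.
      by rewrite /bump; case: (i <= l)%N => //=; rewrite ltnW.
    by rewrite (nth_mktuple _ _ (Ordinal lr)) (tnth_nth 0).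
  have li : (i <= l)%N by apply: leq_trans rl; rewrite -ltnS.
  rewrite !split_argsr /= /bump ?li ?subSS //.
  by rewrite e ltnS add1n.
  by rewrite subnKC.
(* Removing a base vector leaves [r.+1] vertical arguments in front, so the differentiated function
   is zero near the point. The index [j] witnesses [r < k.+1], under which horizontality is a
   condition. *)
rewrite (_ : 'D__ _ _ = 0) ?mulr0 //.
apply: etrans (derive_cst (0 : R^o) (row_mx (c m) y) _); apply: near_eq_derive.
apply: (@near_open _ (prod_cimg t c c')); [exact: prod_cimg_open|exact: zP|].
move=> z zPhi; apply: w_hor => [|i ir].
  by rewrite -subn_gt0; apply: leq_ltn_trans (ltn_ord j).
rewrite tnth_mktuple [tnth [tuple _ | _ < _] i]tnth_mktuple split_argsl /=.
  exact: dcinv_vert.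
have ij : (i < r.+1 + j)%N by rewrite addSn ltnS (leq_trans ir) ?leq_addr.
by rewrite /bump [(_ <= i)%N]leqNgt ij.
Qed.

End LocalSymbol.

(** The bound [r <= N.+1] secures a non-zero symbol: for larger [r] the contractions with [L]
    vanish, and then so does the symbol. For [k = 0] the kernel of [w p] is a hyperplane that need
    not be vertical, hence [0 < k]. The truncated subtraction is a true difference, because [r = 2]
    forces [0 < k] and so the inclusion of kernels. *)
Theorem theorem8 (R : realType) (n f k r N : nat)
    (M : manifold R n) (F : manifold R f) (P : manifold R (n + f)) (proj : P -> M)
    (hpi : fiber_bundle F proj)
    (hr : (0 < r)%N) (hrk : (r <= k.+1)%N) (hn : (k.+1 - r <= n)%N)
    (w : P -> altform k.+1 'rV[R]_(n + f) (GRing.regular R))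
    (L : P -> {vspace 'rV[R]_(n + f)}) :
  multilagrangian proj r N w -> multilagrangian_distribution proj r N w L ->
  let hw := vsymbol proj hrk w in
  [/\ (r <= N.+1)%N -> polylagrangian F N hw,
      polylagrangian_distribution N hw L,
      (0 < k)%N ->
        forall p, (formker (w p) <= linfun vsval @: formker (hw p))%VS &
      multipresymplectic proj r N w ->
        ((r <= N.+1)%N -> polypresymplectic F N hw) /\
        forall p, (\dim (formker (hw p)) - \dim (formker (w p)) <= 1)%N].
Proof.
case: r hr hrk hn => // r _ hrk hn.
move=> [ws wrank wc wP] [Ld LP] hw.
have onto := tmap_proj_onto hpi.
have w_hor p : horizontal r.+1 (vert proj p) (w p) by case: (wP p).
have dW : \dim {: 'rV[R]_(n + f)} = (n + f)%N by rewrite dimvf /dim /= mul1n.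
have dT : \dim {: 'rV[R]_n} = n by rewrite dimvf /dim /= mul1n.
have hwP p : polylagrangian_subspace N (hw p) (linfun vsval @^-1: L p)%VS.
  exact: (symbol_polylagrangian _ (onto p) (LP p)).
have dvert q : \dim {: subvs_of (vert proj q)} = f.
  apply: etrans (dim_subvs (vert proj q)) _.
  have e := etrans (dim_vert (onto q)) (congr1 (addn _) dT).
  exact: esym (addIn (etrans (addnC f n) (etrans (esym dW) e))).
have poly : (r.+1 <= N.+1)%N -> polylagrangian F N hw.
  rewrite ltnS => rN.
  (* The bound [k.+1 - r <= n] provides a non-zero value in which the symbol takes its
     coefficients. *)
  have [e e0] : exists e : altform (k.+1 - r.+1) 'rV[R]_n R^o, e != 0.
    by apply: altform_nonzero; rewrite dT.
  split.
  - exact: smooth_vsymbol.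
  (* The constant rank is read off at a reference point; for empty [P] any number serves. *)
  - have [[p0 _]|noP] := pselect (exists p : P, True); last first.
      by exists 0%N => p; case: noP; exists p.
    exists (\dim (formker (hw p0))) => p.
    apply: (dim_formker_polylagrangian _ e0 rN (hwP p) (hwP p0)).
    exact: etrans (dvert p) (esym (dvert p0)).
  - exact: vclosed_vsymbol.
  - move=> p; split; last by exists (linfun vsval @^-1: L p)%VS.
    exact: polylagrangian_subspace_neq0 (hwP p) e0 rN.
split=> //.
- split=> // p; first by case: (LP p).
- case: k => // k in w hrk hn hw ws wrank wc wP LP w_hor hwP poly *.
  move=> _ p; apply: formker_symbol.
  have [_ w0 _] := wP p; apply: (formker_vert (onto p) _ w0 (LP p)).
  by rewrite dT -subSS.
- move=> [_ kn r2]; split=> [rN|p]; first by split=> //; exact: poly.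
  case: r2 => r1; subst r.
  case: k => // k in w hrk hn hw ws wrank wc wP LP w_hor hwP poly kn *.
  rewrite leq_subLR.
  exact: (dim_formker_symbol (onto p) _ (etrans dT (esym kn)) (w_hor p)).
Qed.
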